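(* Let $f$ satisfy (f1) and suppose $f_0=+\infty$ and $f_\infty\in(0,+\infty)$. Then for every $\lambda\in(0,\lambda_1/f_\infty)$, problem (MO) has two solutions $u^+$ and $u^-$ such that $u^+$ is positive and strictly concave in $(0,1)$ and $u^-$ is negative and strictly convex in $(0,1)$.
   Context: Let $N\ge 1$ be an integer and $f:\mathbb{R}\to\mathbb{R}$ continuous. For $\lambda\ge 0$, problem (MO) is: find $u\in C^2[0,1]$ with $\left((u'(r))^N\right)'=\lambda^N N r^{N-1} f(-u(r))$ for $0<r<1$ and $u'(0)=u(1)=0$. Condition (f1): $f\in C(\mathbb{R},\mathbb{R})$ and $f(s)s^N>0$ for all $s\neq0$. The quantities $f_0,f_\infty\in[0,+\infty]$ are defined by $f_0^N=\lim_{s\to0} f(s)/s^N$ and $f_\infty^N=\lim_{|s|\to+\infty} f(s)/s^N$ (limits assumed to exist in $[0,+\infty]$). $\lambda_1>0$ denotes the first eigenvalue of $\left((-v')^N\right)'=\lambda^N N r^{N-1}v^N$ in $(0,1)$, $v'(0)=v(1)=0$, i.e. the unique $\lambda>0$ for which this problem has a solution $v\in C^2[0,1]$ positive in $(0,1)$. *)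

(* Defs.v *)
From Stdlib Require Import Reals Lra.
Open Scope R_scope.

Definition deriv01 (u u' : R -> R) : Prop :=
  forall x, 0 <= x <= 1 ->
    limit1_in (fun y => (u y - u x) / (y - x))
              (fun y => 0 <= y <= 1 /\ y <> x) (u' x) x.

Definition cont01 (g : R -> R) : Prop :=
  forall x, 0 <= x <= 1 -> limit1_in g (fun y => 0 <= y <= 1) (g x) x.

Definition C2_01 (u u1 u2 : R -> R) : Prop :=
  deriv01 u u1 /\ deriv01 u1 u2 /\ cont01 u2.

Definition solves_MO (N : nat) (f : R -> R) (lam : R) (u : R -> R) : Prop :=
  exists u1 u2 : R -> R,
    C2_01 u u1 u2 /\ u1 0 = 0 /\ u 1 = 0 /\
    forall r, 0 < r < 1 ->
      derivable_pt_lim (fun s => (u1 s) ^ N) r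
        (lam ^ N * INR N * r ^ (N - 1) * f (- u r)).

Definition pos_eigenfunction (N : nat) (lam : R) (v : R -> R) : Prop :=
  exists v1 v2 : R -> R,
    C2_01 v v1 v2 /\ v1 0 = 0 /\ v 1 = 0 /\
    (forall r, 0 < r < 1 -> 0 < v r) /\
    forall r, 0 < r < 1 ->
      derivable_pt_lim (fun s => (- v1 s) ^ N) r
        (lam ^ N * INR N * r ^ (N - 1) * (v r) ^ N).

Definition first_eigenvalue (N : nat) (lam1 : R) : Prop :=
  0 < lam1 /\ (exists v, pos_eigenfunction N lam1 v) /\
  forall lam, 0 < lam -> (exists v, pos_eigenfunction N lam v) -> lam = lam1.

Definition cond_f1 (N : nat) (f : R -> R) : Prop :=
  continuity f /\ forall s, s <> 0 -> f s * s ^ N > 0.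

Definition f0_infinite (N : nat) (f : R -> R) : Prop :=
  forall M, exists d, 0 < d /\
    forall s, 0 < Rabs s < d -> f s / s ^ N > M.

Definition finf_is (N : nat) (f : R -> R) (finf : R) : Prop :=
  forall eps, 0 < eps -> exists K,
    forall s, Rabs s > K -> Rabs (f s / s ^ N - finf ^ N) < eps.

Definition strictly_concave01 (u : R -> R) : Prop :=
  forall x y t, 0 < x < 1 -> 0 < y < 1 -> x <> y -> 0 < t < 1 ->
    u (t * x + (1 - t) * y) > t * u x + (1 - t) * u y.

Definition strictly_convex01 (u : R -> R) : Prop :=
  forall x y t, 0 < x < 1 -> 0 < y < 1 -> x <> y -> 0 < t < 1 ->
    u (t * x + (1 - t) * y) < t * u x + (1 - t) * u y.

(* Main.v *)
Require Import Defs.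
From Stdlib Require Import Reals ZArith Lra Lia Psatz Classical ClassicalEpsilon.
From mathcomp Require filter.
From Coquelicot Require Import Coquelicot.
Open Scope R_scope.

(** Reflecting [f] to [(-1)^N f(-s)] turns both solutions into positive radial
    profiles [V], i.e. solutions of the first order system [V' = - A^(1/N)],
    [A' = N r^(N-1) lam^N f(V)] with [A 0 = 0] and [V 1 = 0].  They are found by
    shooting from [V 0 = d].  For small [d], [f_0 = +oo] forces [V] to vanish
    before [r = 1].  For large [d], assume [V 1 <= 0] and compare with the
    eigenfunction [phi]: since [lam f_oo < lam_1], a bound [V <= c phi] with
    [c >= c0] improves to [V <= t c phi] with a fixed [t < 1]; hence
    [V <= c0 phi], which bounds [d].  Since [f] is merely continuous, the
    initial value problem may have many solutions, so the intermediate value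
    theorem is applied to the Euler polygons, which depend continuously on [d],
    and the mesh is sent to zero along a free ultrafilter. *)

(** The comparison for large [d] takes two integrations: the bound on [A] is integrated from
    [r = 0], where [A] vanishes, and the bound on [V] from [r = 1], where [V 1 <= 0 = phi 1]. The
    additive constant in the growth bound of the nonlinearity costs a term [C r^N] in [A], which is
    absorbed because (-phi')^N is at least [b r^N] for some [b > 0]. Without uniqueness, the values
    [V 1] reached from one [d] need not coincide, so the sign conditions at both ends of the
    shooting interval are proved for every solution; the polygons then inherit them for most meshes.
    The ultrafilter takes the place of a compactness theorem: it provides limits at all [r] at once,
    without subsequences, and finitely many properties of most meshes hold at a common mesh. The
    other obstacle is the degeneracy at [r = 0], where [A] vanishes and the N-th root is not
    differentiable for [N >= 2]. Writing [A = r^N w] with [w] continuous and positive turns V' into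
    - r w^(1/N), which is regular up to 0. *)

Record free_ultrafilter (U : (nat -> Prop) -> Prop) : Prop := {
  uf_mono : forall P Q : nat -> Prop, (forall n, P n -> Q n) -> U P -> U Q;
  uf_and : forall P Q : nat -> Prop, U P -> U Q -> U (fun n => P n /\ Q n);
  uf_ex : forall P : nat -> Prop, U P -> exists n, P n;
  uf_tail : forall k, U (fun n => (k <= n)%nat);
  uf_dec : forall P : nat -> Prop, U P \/ U (fun n => ~ P n)
}.

Lemma free_ultrafilter_exists : exists U, free_ultrafilter U.
Proof.
destruct (filter.ultraFilterLemma filter.eventually_filter) as [U [HU Hsub]].
pose proof (@filter.ultra_proper _ _ HU) as HP.
pose proof (@filter.filter_filter _ _ HP) as HF.
exists U. split.
- intros P Q H HPU. exact (@filter.filterS _ _ HF P Q H HPU).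
- intros P Q H1 H2. exact (@filter.filterI _ _ HF P Q H1 H2).
- intros P H. exact (@filter.filter_ex _ _ HP _ H).
- intros k. apply Hsub. exists k. exact I.
  intros n Hn. apply (ssrbool.elimT ssrnat.leP Hn).
- intros P. exact (filter.in_ultra_setVsetC P HU).
Qed.

(** * Ultralimits *)

Definition ulim (U : (nat -> Prop) -> Prop) (x : nat -> R) (l : R) : Prop :=
  forall eps, 0 < eps -> U (fun n => Rabs (x n - l) < eps).

(** The limit is the supremum of the [a] that lie below [x n] for [U]-most [n]. The upper estimate
    comes from [uf_dec]. *)
Lemma ulim_exists U (HU : free_ultrafilter U) (x : nat -> R) (m M : R) :
  (forall n, m <= x n <= M) -> exists l, m <= l <= M /\ ulim U x l.
Proof.
intros Hx.
assert (HT : U (fun _ => True)).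
{ apply (uf_mono U HU (fun n => (0 <= n)%nat)); [auto|apply (uf_tail U HU)]. }
pose (E := fun a => U (fun n => a <= x n)).
destruct (completeness E) as [l [Hub Hlub]].
- exists M. intros a Ha. destruct (uf_ex U HU _ Ha) as [n Hn].
  generalize (Hx n); lra.
- exists m. unfold E. apply (uf_mono U HU (fun _ => True)); [|exact HT].
  intros n _. apply Hx.
- exists l. split; [split|].
  + apply Hub. unfold E. apply (uf_mono U HU (fun _ => True)); [|exact HT].
    intros n _. apply Hx.
  + apply Hlub. intros a Ha. destruct (uf_ex U HU _ Ha) as [n Hn].
    generalize (Hx n); lra.
  + intros eps Heps.
    assert (H1 : U (fun n => l - eps < x n)).
    { apply NNPP. intros Hn.
      assert (l <= l - eps); [|lra].
      apply Hlub. intros a Ha. apply Rnot_lt_le. intros Hlt. apply Hn.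
      apply (uf_mono U HU (fun n => a <= x n)); [|exact Ha]. intros n ?; lra. }
    assert (H2 : U (fun n => x n < l + eps)).
    { destruct (uf_dec U HU (fun n => l + eps / 2 <= x n)) as [H|H].
      - specialize (Hub _ H). lra.
      - apply (uf_mono U HU _ _) with (2 := H). intros n Hn. lra. }
    apply (uf_mono U HU _ _) with (2 := uf_and U HU _ _ H1 H2).
    intros n [A B]. apply Rabs_def1; lra.
Qed.

(* Continuous convergence of grid functions: [X n i] is the value at the node
   [i / (n + 1)]. *)
Definition ccv (U : (nat -> Prop) -> Prop) (X : nat -> nat -> R) (r l : R) : Prop :=
  forall eps, 0 < eps -> exists eta, 0 < eta /\
    U (fun n => forall i, Rabs (INR i / INR (S n) - r) < eta ->
                          Rabs (X n i - l) < eps).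

Lemma ccv_comp U (HU : free_ultrafilter U) (g : R -> R) X r l :
  continuity_pt g l -> ccv U X r l -> ccv U (fun n i => g (X n i)) r (g l).
Proof.
intros Hg HX eps Heps.
destruct (Hg eps Heps) as [d [Hd H]].
destruct (HX d Hd) as [eta [Heta HUn]].
exists eta. split; [exact Heta|].
apply (uf_mono U HU _ _) with (2 := HUn). intros n Hn i Hi.
specialize (Hn i Hi).
(* [continuity_pt] only speaks of points different from [l]. *)
destruct (Req_dec (X n i) l) as [->|Hne].
- rewrite Rminus_diag. rewrite Rabs_R0. exact Heps.
- apply (H (X n i)). split; [split; [exact I|auto]|exact Hn].
Qed.

Lemma ccv_grid U (HU : free_ultrafilter U) r :
  ccv U (fun n i => INR i / INR (S n)) r r.
Proof.
intros eps Heps. exists eps. split; [exact Heps|].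
apply (uf_mono U HU (fun n => (0 <= n)%nat)); [auto|apply (uf_tail U HU)].
Qed.

Lemma ccv_mult U (HU : free_ultrafilter U) X Y r l m :
  ccv U X r l -> ccv U Y r m -> ccv U (fun n i => X n i * Y n i) r (l * m).
Proof.
intros HX HY eps Heps.
(* Since [e <= 1], the product of the two errors is below [e], and the total error below
   [e * (1 + Rabs l + Rabs m)]. *)
pose (e := Rmin 1 (eps / (Rabs l + Rabs m + 1))).
pose proof (Rabs_pos l) as Hl. pose proof (Rabs_pos m) as Hm.
assert (He : 0 < e).
{ apply Rmin_pos; [lra|]. apply Rdiv_lt_0_compat; lra. }
assert (He2 : e * (Rabs l + Rabs m + 1) <= eps).
{ apply Rle_trans with (eps / (Rabs l + Rabs m + 1) * (Rabs l + Rabs m + 1)).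
  - apply Rmult_le_compat_r; [lra|apply Rmin_r].
  - right. field. lra. }
assert (He1 : e <= 1) by apply Rmin_l.
destruct (HX e He) as [a [Ha HUa]]. destruct (HY e He) as [b [Hb HUb]].
exists (Rmin a b). split; [apply Rmin_pos; assumption|].
apply (uf_mono U HU _ _) with (2 := uf_and U HU _ _ HUa HUb).
intros n [H1 H2] i Hi.
assert (A : Rabs (X n i - l) < e).
{ apply H1. apply Rlt_le_trans with (1 := Hi). apply Rmin_l. }
assert (B : Rabs (Y n i - m) < e).
{ apply H2. apply Rlt_le_trans with (1 := Hi). apply Rmin_r. }
replace (X n i * Y n i - l * m) with
  ((X n i - l) * (Y n i - m) + (X n i - l) * m + l * (Y n i - m)) by ring.
eapply Rle_lt_trans; [apply Rabs_triang|].
eapply Rle_lt_trans; [apply Rplus_le_compat_r, Rabs_triang|].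
rewrite !Rabs_mult.
pose proof (Rabs_pos (X n i - l)). pose proof (Rabs_pos (Y n i - m)).
assert (Rabs (X n i - l) * Rabs (Y n i - m) < e * 1) by nra.
nra.
Qed.

Lemma ccv_opp U (HU : free_ultrafilter U) X r l :
  ccv U X r l -> ccv U (fun n i => - X n i) r (- l).
Proof.
intros HX. apply (ccv_comp U HU (fun x => - x)); [|exact HX].
apply (continuity_pt_opp (fun x => x)), derivable_continuous_pt, derivable_pt_id.
Qed.

(** * Grid nodes and mesh size *)

Definition node (n : nat) (r : R) : nat := Z.to_nat (Int_part (r * INR (S n))).

Lemma INR_S_pos n : 0 < INR (S n).
Proof. apply lt_0_INR; lia. Qed.

Lemma node_spec n r : 0 <= r ->
  r - / INR (S n) < INR (node n r) / INR (S n) <= r.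
Proof.
intros Hr. pose proof (INR_S_pos n) as Hn.
destruct (base_Int_part (r * INR (S n))) as [H1 H2].
assert (0 <= r * INR (S n)) by nra.
assert (Hz : (-1 < Int_part (r * INR (S n)))%Z).
{ apply lt_IZR. simpl (IZR (-1)). lra. }
unfold node. rewrite (INR_IZR_INZ (Z.to_nat _)), Z2Nat.id by lia.
split.
- apply Rmult_lt_reg_r with (INR (S n)); [lra|].
  unfold Rdiv. rewrite Rmult_assoc, Rinv_l, Rmult_minus_distr_r, Rinv_l by lra. lra.
- apply Rmult_le_reg_r with (INR (S n)); [lra|].
  unfold Rdiv. rewrite Rmult_assoc, Rinv_l by lra. lra.
Qed.

Lemma mesh_small U (HU : free_ultrafilter U) eps :
  0 < eps -> U (fun n => / INR (S n) < eps).
Proof.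
intros Heps. destruct (archimed_cor1 eps Heps) as [k [Hk Hk0]].
apply (uf_mono U HU (fun n => (k <= n)%nat)); [|apply (uf_tail U HU)].
intros n Hn. apply Rle_lt_trans with (2 := Hk).
apply Rinv_le_contravar; [apply lt_0_INR; lia|apply le_INR; lia].
Qed.

Lemma ccv_node U (HU : free_ultrafilter U) X r l eps :
  0 <= r -> 0 < eps -> ccv U X r l -> U (fun n => Rabs (X n (node n r) - l) < eps).
Proof.
intros Hr Heps HX. destruct (HX eps Heps) as [eta [Heta H]].
apply (uf_mono U HU _ _) with (2 := uf_and U HU _ _ H (mesh_small U HU eta Heta)).
intros n [H1 H2]. apply H1. pose proof (node_spec n r Hr). apply Rabs_def1; lra.
Qed.

(** * Limits of Euler schemes *)

Section EulerLimit.

Variables (U : (nat -> Prop) -> Prop) (HU : free_ultrafilter U).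
Variables (X Y : nat -> nat -> R).
Hypothesis HXY : forall n i, X n (S i) = X n i + Y n i / INR (S n).

(** A discrete mean value inequality. *)
Lemma euler_increment n i j m M :
  (i <= j)%nat -> (forall k, (i <= k < j)%nat -> m <= Y n k <= M) ->
  m * ((INR j - INR i) / INR (S n)) <= X n j - X n i
    <= M * ((INR j - INR i) / INR (S n)).
Proof.
intros Hij. pose proof (INR_S_pos n) as Hn.
induction Hij as [|j Hij IH]; intros HY.
- unfold Rdiv. rewrite !Rminus_diag, Rmult_0_l, !Rmult_0_r. lra.
- rewrite HXY, (S_INR j).
  assert (HYj : m <= Y n j <= M) by (apply HY; lia).
  destruct IH as [IH1 IH2]; [intros k Hk; apply HY; lia|].
  pose proof (Rinv_0_lt_compat _ Hn). unfold Rdiv in *.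
  split; nra.
Qed.

Lemma euler_lipschitz L n i j :
  (forall k, Rabs (Y n k) <= L) ->
  Rabs (X n j - X n i) <= L * Rabs (INR j / INR (S n) - INR i / INR (S n)).
Proof.
intros HY.
assert (HY' : forall k, - L <= Y n k <= L).
{ intros k. specialize (HY k). apply Rabs_le_between in HY. exact HY. }
assert (aux : forall i j, (i <= j)%nat ->
  Rabs (X n j - X n i) <= L * Rabs (INR j / INR (S n) - INR i / INR (S n))).
{ clear i j. intros i j Hij.
  destruct (euler_increment n i j (- L) L Hij) as [H1 H2]; [intros; apply HY'|].
  rewrite (Rabs_pos_eq (INR j / INR (S n) - _)).
  - unfold Rdiv in *. rewrite <- Rmult_minus_distr_r.
    apply Rabs_le. lra.
  - apply le_INR in Hij. unfold Rdiv. rewrite <- Rmult_minus_distr_r.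
    pose proof (Rinv_0_lt_compat _ (INR_S_pos n)). nra. }
destruct (Nat.le_ge_cases i j) as [H|H].
- apply aux, H.
- rewrite (Rabs_minus_sym (X n j)), (Rabs_minus_sym (INR j / _)). apply aux, H.
Qed.

(** The grid functions share the Lipschitz constant [L], so convergence along the single node just
    below [r] spreads to all nodes near [r]. *)
Lemma euler_ccv L m M r :
  (forall n k, Rabs (Y n k) <= L) -> (forall n, m <= X n 0%nat <= M) -> 0 <= r ->
  exists l, ccv U X r l.
Proof.
intros HY HX0 Hr.
assert (HL : 0 <= L).
{ eapply Rle_trans; [apply Rabs_pos|apply (HY 0%nat 0%nat)]. }
destruct (ulim_exists U HU (fun n => X n (node n r)) (m - L * r) (M + L * r))
  as [l [_ Hl]].
- intros n. pose proof (euler_lipschitz L n 0 (node n r) (HY n)) as H.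
  pose proof (node_spec n r Hr) as Hnode.
  replace (INR 0 / INR (S n)) with 0 in H by (simpl; unfold Rdiv; ring).
  rewrite Rminus_0_r in H.
  rewrite (Rabs_pos_eq (INR (node n r) / INR (S n))) in H.
  2:{ apply Rmult_le_pos; [apply pos_INR|].
      left; apply Rinv_0_lt_compat, INR_S_pos. }
  apply Rabs_le_between in H. specialize (HX0 n). nra.
- exists l. intros eps Heps.
  (* The nodes [i] and [node n r] both lie within [eta] of [r], hence at distance at most [2 * eta];
     [L + 1] avoids a division by zero. *)
  set (eta := eps / (4 * (L + 1))).
  assert (Heta : 0 < eta) by (apply Rdiv_lt_0_compat; lra).
  assert (HLe : L * (2 * eta) <= eps / 2).
  { apply Rle_trans with ((L + 1) * (2 * eta)); [nra|].
    right. unfold eta. field. lra. }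
  exists eta. split; [exact Heta|].
  assert (Heps2 : 0 < eps / 2) by lra.
  apply (uf_mono U HU _ _)
    with (2 := uf_and U HU _ _ (Hl _ Heps2) (mesh_small U HU eta Heta)).
  intros n [H1 H2] i Hi.
  pose proof (euler_lipschitz L n (node n r) i (HY n)) as H.
  pose proof (node_spec n r Hr) as Hnode.
  assert (Rabs (INR i / INR (S n) - INR (node n r) / INR (S n)) <= 2 * eta).
  { apply Rabs_def2 in Hi. apply Rabs_le. lra. }
  replace (X n i - l) with ((X n i - X n (node n r)) + (X n (node n r) - l)) by ring.
  eapply Rle_lt_trans; [apply Rabs_triang|]. nra.
Qed.

(** The discrete mean value inequality in the limit. Leaving [p] free in [[r, s]] lets one estimate
    serve right derivatives ([p = r]) and left derivatives ([p = s]). *)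
Lemma euler_increment_limit (x : R -> R) (r p s y eps eta : R) :
  0 <= r -> r <= p <= s -> 0 < eps -> s - r < eta ->
  ccv U X r (x r) -> ccv U X s (x s) ->
  U (fun n => forall i, Rabs (INR i / INR (S n) - p) < eta ->
                        Rabs (Y n i - y) < eps) ->
  Rabs (x s - x r - y * (s - r)) <= eps * (s - r).
Proof.
intros Hr Hp Heps Heta Hxr Hxs HY. assert (Hrs : r <= s) by lra.
apply le_epsilon. intros e He.
set (K := Rabs y + eps).
assert (HK : 0 < K) by (unfold K; generalize (Rabs_pos y); lra).
(* The slack [e] pays for the errors of [X] at the two end nodes, [2 * e'], and for replacing
   [s - r] by the distance [q] of these nodes, at most [K * e']. *)
set (e' := e / (4 * (1 + K))).
assert (He' : 0 < e') by (apply Rdiv_lt_0_compat; lra).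
assert (HKe : 4 * e' + 4 * (K * e') = e) by (unfold e'; field; lra).
(* [node n r] may lie almost one mesh to the left of [r]; a mesh below [eta - (s - r)] keeps all
   nodes in between within [eta] of [p]. *)
assert (Hmin : 0 < Rmin e' (eta - (s - r))) by (apply Rmin_pos; lra).
destruct (uf_ex U HU _ (uf_and U HU _ _ HY (uf_and U HU _ _
  (mesh_small U HU _ Hmin) (uf_and U HU _ _
  (ccv_node U HU X r _ e' Hr He' Hxr)
  (ccv_node U HU X s _ e' (Rle_trans _ _ _ Hr Hrs) He' Hxs))))) as [n [H1 [H2 [H3 H4]]]].
pose proof (INR_S_pos n) as Hn.
pose proof (node_spec n r Hr) as Nr.
pose proof (node_spec n s (Rle_trans _ _ _ Hr Hrs)) as Ns.
pose proof (Rmin_l e' (eta - (s - r))). pose proof (Rmin_r e' (eta - (s - r))).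
assert (Hle : (node n r <= node n s)%nat).
{ unfold node.
  assert ((Int_part (r * INR (S n)) <= Int_part (s * INR (S n)))%Z); [|lia].
  destruct (base_Int_part (r * INR (S n))) as [A1 A2].
  destruct (base_Int_part (s * INR (S n))) as [B1 B2].
  assert (r * INR (S n) <= s * INR (S n)) by nra.
  assert ((Int_part (r * INR (S n)) < Int_part (s * INR (S n)) + 1)%Z); [|lia].
  apply lt_IZR. rewrite plus_IZR. lra. }
destruct (euler_increment n (node n r) (node n s) (y - eps) (y + eps) Hle) as [C1 C2].
{ intros k Hk.
  assert (Hk1 : INR (node n r) / INR (S n) <= INR k / INR (S n)).
  { apply Rmult_le_compat_r; [left; apply Rinv_0_lt_compat; lra|].
    apply le_INR; lia. }
  assert (Hk2 : INR k / INR (S n) <= INR (node n s) / INR (S n)).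
  { apply Rmult_le_compat_r; [left; apply Rinv_0_lt_compat; lra|].
    apply le_INR; lia. }
  assert (D : Rabs (Y n k - y) < eps).
  { apply H1. apply Rabs_def1; lra. }
  apply Rabs_def2 in D. lra. }
set (q := (INR (node n s) - INR (node n r)) / INR (S n)) in *.
assert (Hq : Rabs (q - (s - r)) <= e').
{ replace q with (INR (node n s) / INR (S n) - INR (node n r) / INR (S n))
    by (unfold q; field; lra).
  apply Rabs_le. lra. }
apply Rabs_def2 in H3. apply Rabs_def2 in H4.
assert (Hyq : Rabs (y * (q - (s - r))) <= Rabs y * e').
{ rewrite Rabs_mult. apply Rmult_le_compat_l; [apply Rabs_pos|exact Hq]. }
apply Rabs_le_between in Hyq. apply Rabs_le_between in Hq.
assert (HKy : Rabs y * e' + eps * e' = K * e') by (unfold K; ring).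
assert (Rabs y * e' >= 0) by (apply Rle_ge, Rmult_le_pos; [apply Rabs_pos|lra]).
apply Rabs_le. split; nra.
Qed.

End EulerLimit.

(* The affine extension to [r < 0] makes the derivative at [0] two-sided. *)
Definition extend_left (x : R -> R) (s r : R) : R :=
  if Rle_dec 0 r then x r else x 0 + s * r.

Lemma extend_left_pos x s r : 0 <= r -> extend_left x s r = x r.
Proof. intros H. unfold extend_left. destruct (Rle_dec 0 r); [reflexivity|lra]. Qed.

(** Continuous convergence of [Y] at the one point [r] makes [Y] almost constant on a whole
    neighbourhood of [r] for most meshes; this gives the derivative there without continuity of
    [y]. *)
Lemma euler_limit_derivable U (HU : free_ultrafilter U) X Y (x y : R -> R) r :
  (forall n i, X n (S i) = X n i + Y n i / INR (S n)) ->
  (forall r, 0 <= r -> ccv U X r (x r)) -> ccv U Y r (y r) -> 0 <= r ->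
  derivable_pt_lim (extend_left x (y 0)) r (y r).
Proof.
intros HXY HX HY Hr eps Heps.
destruct (HY (eps / 2)) as [eta [Heta Hn]]; [lra|].
(* For [r > 0] the increment is kept below [r], so that [r + h] stays positive and the affine
   extension is not met. *)
assert (Hd : 0 < Rmin eta (if Rlt_dec 0 r then r else eta)).
{ apply Rmin_pos; [exact Heta|]. destruct (Rlt_dec 0 r); assumption. }
exists (mkposreal _ Hd). simpl. intros h Hh0 Hh.
assert (Hh1 : Rabs h < eta) by (eapply Rlt_le_trans; [exact Hh|apply Rmin_l]).
assert (Hkey : Rabs (extend_left x (y 0) (r + h) - extend_left x (y 0) r - y r * h)
  <= eps / 2 * Rabs h).
{ rewrite (extend_left_pos x _ r Hr). apply Rabs_def2 in Hh1.
  destruct (Rle_or_lt 0 h) as [Hpos|Hneg].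
  - rewrite extend_left_pos by lra. rewrite (Rabs_pos_eq h Hpos).
    replace h with (r + h - r) at 2 3 by ring.
    apply (euler_increment_limit U HU X Y HXY x r r (r + h) (y r) (eps / 2) eta);
      try lra; auto. apply HX; lra.
  - destruct (Rlt_dec 0 r) as [Hr0|Hr0].
    + assert (Hh2 : Rabs h < r) by (eapply Rlt_le_trans; [exact Hh|apply Rmin_r]).
      apply Rabs_def2 in Hh2.
      rewrite extend_left_pos by lra. rewrite (Rabs_left h Hneg).
      replace (x (r + h) - x r - y r * h)
        with (- (x r - x (r + h) - y r * (r - (r + h)))) by ring.
      rewrite Rabs_Ropp.
      replace (- h) with (r - (r + h)) by ring.
      apply (euler_increment_limit U HU X Y HXY x (r + h) r r (y r) (eps / 2) eta);
        try lra; auto. apply HX; lra.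
    + replace r with 0 in * by lra. rewrite Rplus_0_l.
      unfold extend_left. destruct (Rle_dec 0 h); [lra|].
      replace (x 0 + y 0 * h - x 0 - y 0 * h) with 0 by ring.
      rewrite Rabs_R0. generalize (Rabs_pos h); nra. }
replace ((extend_left x (y 0) (r + h) - extend_left x (y 0) r) / h - y r)
  with ((extend_left x (y 0) (r + h) - extend_left x (y 0) r - y r * h) * / h)
  by (field; exact Hh0).
rewrite Rabs_mult, Rabs_inv.
pose proof (Rabs_pos_lt h Hh0).
apply Rmult_lt_reg_r with (Rabs h); [assumption|].
rewrite Rmult_assoc, Rinv_l by lra. nra.
Qed.

(** * Shooting without uniqueness *)

Section Shooting.

Variables (G a g : R -> R) (L : R).
Hypotheses (cG : continuity G) (ca : continuity a) (cg : continuity g).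
Hypotheses (bG : forall x, Rabs (G x) <= L) (ba : forall x, Rabs (a x) <= L)
  (bg : forall x, Rabs (g x) <= L).

Definition shoot_sol (V A : R -> R) : Prop :=
  A 0 = 0 /\ forall r, 0 <= r ->
    derivable_pt_lim V r (- G (A r)) /\ derivable_pt_lim A r (a r * g (V r)).

Fixpoint euler (d : R) (n i : nat) : R * R :=
  match i with
  | O => (d, 0)
  | S j => let p := euler d n j in
      (fst p + (- G (snd p)) / INR (S n),
       snd p + (a (INR j / INR (S n)) * g (fst p)) / INR (S n))
  end.

Lemma euler_continuity n i :
  continuity (fun d => fst (euler d n i)) /\ continuity (fun d => snd (euler d n i)).
Proof.
induction i as [|i [IH1 IH2]]; simpl.
- split; [apply derivable_continuous, derivable_id|apply continuity_const; intros ? ?; reflexivity].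
- split.
  + apply continuity_plus with (f2 := fun d => - G (snd (euler d n i)) / INR (S n)); [exact IH1|].
    apply continuity_mult with (f1 := fun d => - G (snd (euler d n i)))
      (f2 := fun _ => / INR (S n)).
    * apply continuity_opp with (f := fun d => G (snd (euler d n i))).
      exact (continuity_comp _ _ IH2 cG).
    * apply continuity_const; intros ? ?; reflexivity.
  + apply continuity_plus
      with (f2 := fun d => a (INR i / INR (S n)) * g (fst (euler d n i)) / INR (S n)); [exact IH2|].
    apply continuity_mult with (f1 := fun d => a (INR i / INR (S n)) * g (fst (euler d n i)))
      (f2 := fun _ => / INR (S n)).
    * apply continuity_scal with (f := fun d => g (fst (euler d n i))).
      exact (continuity_comp _ _ IH1 cg).
    * apply continuity_const; intros ? ?; reflexivity.
Qed.

(** The initial value depends on the mesh because the intermediate value theorem will pick a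
    different one for each [n]. The bounds on [G], [a] and [g] give Lipschitz constants [L] and
    [L * L] independent of [n], and their continuity carries the equations to the limit. *)
Lemma euler_converges U (HU : free_ultrafilter U) (d : nat -> R) m M :
  (forall n, m <= d n <= M) ->
  exists V A, shoot_sol V A /\ ulim U d (V 0) /\
    ccv U (fun n i => fst (euler (d n) n i)) 1 (V 1).
Proof.
intros Hd.
set (X := fun n i => fst (euler (d n) n i)).
set (Z := fun n i => snd (euler (d n) n i)).
(* The guard [0 <= r] sits inside the existential, so that choice yields a total function. *)
assert (HX : forall r, exists l, 0 <= r -> ccv U X r l).
{ intros r. destruct (Rle_dec 0 r) as [Hr|Hr]; [|exists 0; lra].
  destruct (euler_ccv U HU X (fun n i => - G (Z n i))) with L m M r as [l Hl]; auto.
  - intros n k. rewrite Rabs_Ropp. apply bG.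
  - exists l; auto. }
assert (HZ : forall r, exists l, 0 <= r -> ccv U Z r l).
{ intros r. destruct (Rle_dec 0 r) as [Hr|Hr]; [|exists 0; lra].
  destruct (euler_ccv U HU Z (fun n i => a (INR i / INR (S n)) * g (X n i)))
    with (L * L) 0 0 r as [l Hl]; auto.
  - intros n k. rewrite Rabs_mult. apply Rmult_le_compat; auto; apply Rabs_pos.
  - intros n. unfold Z; simpl; lra.
  - exists l; auto. }
pose (x := fun r => proj1_sig (constructive_indefinite_description _ (HX r))).
pose (z := fun r => proj1_sig (constructive_indefinite_description _ (HZ r))).
assert (Hx : forall r, 0 <= r -> ccv U X r (x r)).
{ intros r. exact (proj2_sig (constructive_indefinite_description _ (HX r))). }
assert (Hz : forall r, 0 <= r -> ccv U Z r (z r)).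
{ intros r. exact (proj2_sig (constructive_indefinite_description _ (HZ r))). }
clearbody x z.
set (y1 := fun r => - G (z r)). set (y2 := fun r => a r * g (x r)).
assert (H0 : 0 <= 0) by lra.
assert (Hz0 : z 0 = 0).
{ apply Rminus_diag_uniq. apply NNPP. intros Hne. apply Rabs_pos_lt in Hne.
  destruct (Hz 0 H0 _ Hne) as [eta [Heta Hn]].
  destruct (uf_ex U HU _ Hn) as [n Hn']. specialize (Hn' 0%nat).
  simpl (INR 0) in Hn'. unfold Rdiv in Hn'.
  rewrite Rmult_0_l, Rminus_0_r, Rabs_R0 in Hn'. specialize (Hn' Heta).
  unfold Z in Hn'. simpl in Hn'. rewrite Rabs_minus_sym in Hn'. lra. }
exists (extend_left x (y1 0)), (extend_left z (y2 0)). split; [split|split].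
- rewrite extend_left_pos by lra. exact Hz0.
- intros r Hr. rewrite !(extend_left_pos _ _ r Hr). split.
  + apply (euler_limit_derivable U HU X (fun n i => - G (Z n i)) x y1); auto.
    apply (ccv_opp U HU (fun n i => G (Z n i))), ccv_comp; auto.
  + apply (euler_limit_derivable U HU Z
      (fun n i => a (INR i / INR (S n)) * g (X n i)) z y2); auto.
    apply (ccv_mult U HU (fun n i => a (INR i / INR (S n)))).
    * apply (ccv_comp U HU a (fun n i => INR i / INR (S n))); auto. apply ccv_grid, HU.
    * apply ccv_comp; auto.
- rewrite extend_left_pos by lra. intros eps Heps.
  destruct (Hx 0 H0 _ Heps) as [eta [Heta Hn]].
  apply (uf_mono U HU _ _) with (2 := Hn). intros n Hn'.
  apply (Hn' 0%nat). simpl (INR 0). unfold Rdiv.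
  rewrite Rmult_0_l, Rminus_0_r, Rabs_R0. exact Heta.
- rewrite extend_left_pos by lra. apply Hx. lra.
Qed.

(** The node of index [S n] lies exactly at [r = 1]. *)
Lemma ccv_end U (HU : free_ultrafilter U) X l eps :
  ccv U X 1 l -> 0 < eps -> U (fun n => Rabs (X n (S n) - l) < eps).
Proof.
intros HX Heps. destruct (HX eps Heps) as [eta [Heta Hn]].
apply (uf_mono U HU _ _) with (2 := Hn). intros n Hn'. apply Hn'.
unfold Rdiv. rewrite Rinv_r, Rminus_diag, Rabs_R0; [exact Heta|].
apply Rgt_not_eq, INR_S_pos.
Qed.

Lemma shooting d0 d1 :
  d0 < d1 ->
  (forall V A, shoot_sol V A -> V 0 = d0 -> V 1 < 0) ->
  (forall V A, shoot_sol V A -> V 0 = d1 -> 0 < V 1) ->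
  exists V A, shoot_sol V A /\ d0 <= V 0 <= d1 /\ V 1 = 0.
Proof.
intros Hd Hneg Hpos.
destruct free_ultrafilter_exists as [U HU].
assert (Hcst : forall d V, ulim U (fun _ => d) (V 0) -> V 0 = d).
{ intros d V H. apply Rminus_diag_uniq. apply NNPP. intros Hne.
  apply Rabs_pos_lt in Hne. destruct (uf_ex U HU _ (H _ Hne)) as [_ Hn].
  rewrite Rabs_minus_sym in Hn. lra. }
assert (U0 : U (fun n => fst (euler d0 n (S n)) < 0)).
{ destruct (euler_converges U HU (fun _ => d0) d0 d0) as [V [A [HVA [HV0 HV1]]]];
    [intros; lra|].
  pose proof (Hneg V A HVA (Hcst _ _ HV0)) as H.
  assert (He : 0 < - V 1) by lra.
  apply (uf_mono U HU _ _) with (2 := ccv_end U HU _ _ _ HV1 He).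
  intros n Hn. apply Rabs_def2 in Hn. lra. }
assert (U1 : U (fun n => 0 < fst (euler d1 n (S n)))).
{ destruct (euler_converges U HU (fun _ => d1) d1 d1) as [V [A [HVA [HV0 HV1]]]];
    [intros; lra|].
  pose proof (Hpos V A HVA (Hcst _ _ HV0)) as H.
  apply (uf_mono U HU _ _) with (2 := ccv_end U HU _ _ _ HV1 H).
  intros n Hn. apply Rabs_def2 in Hn. lra. }
(* For the exceptional meshes without a sign change any value will do; the implication makes the
   choice total. *)
assert (Hex : forall n, exists d, d0 <= d <= d1 /\
  (fst (euler d0 n (S n)) < 0 /\ 0 < fst (euler d1 n (S n)) ->
   fst (euler d n (S n)) = 0)).
{ intros n.
  destruct (classic (fst (euler d0 n (S n)) < 0 /\ 0 < fst (euler d1 n (S n))))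
    as [[H0 H1]|Hn].
  - destruct (IVT (fun d => fst (euler d n (S n))) d0 d1
      (proj1 (euler_continuity n (S n))) Hd H0 H1) as [d [Hd' Hz]].
    exists d. auto.
  - exists d0. split; [lra|tauto]. }
pose (d := fun n => proj1_sig (constructive_indefinite_description _ (Hex n))).
assert (Hdn : forall n, d0 <= d n <= d1 /\
  (fst (euler d0 n (S n)) < 0 /\ 0 < fst (euler d1 n (S n)) ->
   fst (euler (d n) n (S n)) = 0)).
{ intros n. exact (proj2_sig (constructive_indefinite_description _ (Hex n))). }
clearbody d.
destruct (euler_converges U HU d d0 d1) as [V [A [HVA [HV0 HV1]]]];
  [intros n; apply Hdn|].
exists V, A. split; [exact HVA|split; [split|]].
- apply Rnot_lt_le. intros H. assert (He : 0 < d0 - V 0) by lra.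
  destruct (uf_ex U HU _ (HV0 _ He)) as [n Hn]. apply Rabs_def2 in Hn.
  generalize (Hdn n); lra.
- apply Rnot_lt_le. intros H. assert (He : 0 < V 0 - d1) by lra.
  destruct (uf_ex U HU _ (HV0 _ He)) as [n Hn]. apply Rabs_def2 in Hn.
  generalize (Hdn n); lra.
- apply NNPP. intros Hne. apply Rabs_pos_lt in Hne.
  destruct (uf_ex U HU _ (uf_and U HU _ _ (uf_and U HU _ _ U0 U1)
    (ccv_end U HU _ _ _ HV1 Hne))) as [n [H01 Hn]].
  rewrite (proj2 (Hdn n) H01), Rminus_0_l, Rabs_Ropp in Hn. lra.
Qed.

End Shooting.

(** * Roots, truncation and calculus on [[0,1]] *)

Lemma pow_lt_mono N x y : (1 <= N)%nat -> 0 <= x < y -> x ^ N < y ^ N.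
Proof.
intros HN Hxy. induction HN as [|N HN IH]; simpl; [lra|].
assert (0 <= x ^ N) by (apply pow_le; lra). nra.
Qed.

Lemma pow_le_inv N x y : (1 <= N)%nat -> 0 <= y -> x ^ N <= y ^ N -> x <= y.
Proof.
intros HN Hy H. apply Rnot_lt_le. intros Hlt.
generalize (pow_lt_mono N y x HN (conj Hy Hlt)). lra.
Qed.

(* [Rpower 0 y = 1] in Stdlib, hence the case distinction. *)
Definition nroot (N : nat) (x : R) : R :=
  if Rlt_dec 0 x then Rpower x (/ INR N) else 0.

Lemma nroot_pos N x : 0 < x -> nroot N x = Rpower x (/ INR N).
Proof. intros H. unfold nroot. destruct (Rlt_dec 0 x); [reflexivity|lra]. Qed.

Lemma nroot_ge0 N x : 0 <= nroot N x.
Proof. unfold nroot. destruct (Rlt_dec 0 x); [left; apply exp_pos|lra]. Qed.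

Lemma nroot_gt0 N x : 0 < x -> 0 < nroot N x.
Proof. intros H. rewrite nroot_pos by assumption. apply exp_pos. Qed.

Lemma nroot_0 N : nroot N 0 = 0.
Proof. unfold nroot. destruct (Rlt_dec 0 0); lra. Qed.

Lemma pow_nroot N x : (1 <= N)%nat -> 0 <= x -> nroot N x ^ N = x.
Proof.
intros HN Hx. unfold nroot. destruct (Rlt_dec 0 x) as [H|H].
- rewrite <- Rpower_pow by apply exp_pos. rewrite Rpower_mult, Rinv_l.
  + apply Rpower_1, H.
  + apply not_0_INR. lia.
- replace x with 0 by lra. apply pow_i. lia.
Qed.

Lemma nroot_eq N x y : (1 <= N)%nat -> 0 <= y -> y ^ N = x -> nroot N x = y.
Proof.
intros HN Hy Hx. assert (0 <= x) by (rewrite <- Hx; apply pow_le, Hy).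
pose proof (pow_nroot N x HN H) as E. pose proof (nroot_ge0 N x).
apply Rle_antisym; apply (pow_le_inv N); auto; lra.
Qed.

Lemma nroot_le N x y : (1 <= N)%nat -> 0 <= y -> x <= y -> nroot N x <= nroot N y.
Proof.
intros HN Hy Hxy. destruct (Rle_dec 0 x) as [Hx|Hx].
- apply (pow_le_inv N); [exact HN|apply nroot_ge0|]. rewrite !pow_nroot; auto.
- unfold nroot at 1. destruct (Rlt_dec 0 x); [lra|apply nroot_ge0].
Qed.

Lemma nroot_lt N x y : (1 <= N)%nat -> 0 <= x < y -> nroot N x < nroot N y.
Proof.
intros HN Hxy. apply Rnot_le_lt. intros H.
assert (nroot N y ^ N <= nroot N x ^ N) by (apply pow_incr; split; [apply nroot_ge0|exact H]).
rewrite !pow_nroot in H0; auto; lra.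
Qed.

Lemma nroot_mult N x y : (1 <= N)%nat -> 0 <= x -> 0 <= y ->
  nroot N (x * y) = nroot N x * nroot N y.
Proof.
intros HN Hx Hy. apply nroot_eq; [exact HN| |].
- apply Rmult_le_pos; apply nroot_ge0.
- rewrite Rpow_mult_distr, !pow_nroot; auto.
Qed.

Lemma nroot_derivable N x : (1 <= N)%nat -> 0 < x ->
  derivable_pt_lim (nroot N) x (nroot N x / (INR N * x)).
Proof.
intros HN Hx.
assert (HN0 : INR N <> 0) by (apply not_0_INR; lia).
apply is_derive_Reals.
apply is_derive_ext_loc with (fun x => Rpower x (/ INR N)).
- exists (mkposreal x Hx). intros y Hy. symmetry. apply nroot_pos.
  apply Rabs_def2 in Hy. unfold minus, plus, opp in Hy; simpl in Hy. lra.
- apply is_derive_Reals. rewrite nroot_pos by exact Hx.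
  replace (Rpower x (/ INR N) / (INR N * x)) with
    (/ INR N * Rpower x (/ INR N - 1)); [apply derivable_pt_lim_power, Hx|].
  unfold Rminus. rewrite Rpower_plus, Rpower_Ropp, Rpower_1 by exact Hx.
  field. lra.
Qed.

Lemma nroot_continuity N : (1 <= N)%nat -> continuity (nroot N).
Proof.
intros HN x. destruct (Rlt_dec 0 x) as [Hx|Hx].
- apply derivable_continuous_pt. eexists. apply nroot_derivable; assumption.
- intros eps Heps.
  (* The root vanishes at [x <= 0], and [y < x + eps ^ N] implies [y < eps ^ N]. *)
  assert (He : 0 < eps ^ N) by (apply pow_lt; lra).
  exists (eps ^ N). split; [exact He|]. intros y [_ Hy].
  simpl in *. unfold Rdist in *.
  replace (nroot N x) with 0 by (unfold nroot; destruct (Rlt_dec 0 x); lra).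
  rewrite Rminus_0_r, Rabs_pos_eq by apply nroot_ge0.
  apply Rabs_def2 in Hy.
  apply Rle_lt_trans with (nroot N (Rmax 0 y)).
  + apply nroot_le; [exact HN|apply Rmax_l|apply Rmax_r].
  + rewrite <- (nroot_eq N (eps ^ N) eps) by (auto; lra).
    apply nroot_lt; [exact HN|]. split; [apply Rmax_l|].
    apply Rmax_lub_lt; lra.
Qed.

Definition clip (lo hi x : R) : R := Rmax lo (Rmin x hi).

Lemma clip_id lo hi x : lo <= x <= hi -> clip lo hi x = x.
Proof. intros H. unfold clip. rewrite Rmin_left, Rmax_right; lra. Qed.

Lemma clip_range lo hi x : lo <= hi -> lo <= clip lo hi x <= hi.
Proof.
intros H. unfold clip. split; [apply Rmax_l|].
apply Rmax_lub; [exact H|apply Rmin_r].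
Qed.

Lemma clip_lipschitz lo hi x y : Rabs (clip lo hi x - clip lo hi y) <= Rabs (x - y).
Proof.
unfold clip, Rmax, Rmin.
destruct (Rle_dec x hi), (Rle_dec y hi);
repeat match goal with |- context [Rle_dec ?a ?b] => destruct (Rle_dec a b) end;
unfold Rabs; repeat match goal with |- context [Rcase_abs ?a] => destruct (Rcase_abs a) end; lra.
Qed.

Lemma clip_continuity lo hi : continuity (clip lo hi).
Proof.
intros x eps Heps. exists eps. split; [exact Heps|]. intros y [_ Hy].
simpl in *. unfold Rdist in *.
eapply Rle_lt_trans; [apply clip_lipschitz|exact Hy].
Qed.

Lemma continuity_clip_bounded (h : R -> R) lo hi : continuity h -> lo <= hi ->
  exists M, 0 <= M /\ forall x, Rabs (h (clip lo hi x)) <= M.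
Proof.
intros Hh Hlh.
destruct (continuity_ab_maj (fun x => Rabs (h x)) lo hi Hlh) as [m [Hm _]].
- intros c _. apply (continuity_pt_comp h Rabs); [apply Hh|apply Rcontinuity_abs].
- exists (Rabs (h m)). split; [apply Rabs_pos|]. intros x.
  apply Hm, clip_range, Hlh.
Qed.

Lemma cont01_pt h : (forall x, 0 <= x <= 1 -> continuity_pt h x) -> cont01 h.
Proof.
intros H x Hx eps Heps. destruct (H x Hx eps Heps) as [d [Hd Hc]].
exists d. split; [exact Hd|]. intros y [_ Hy].
destruct (Req_dec x y) as [->|Hne].
- simpl. unfold Rdist. rewrite Rminus_diag, Rabs_R0. exact Heps.
- apply Hc. split; [split; [exact I|exact Hne]|exact Hy].
Qed.

Lemma continuity_Ropp : continuity Ropp.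
Proof. apply (continuity_opp (fun x => x)), derivable_continuous, derivable_id. Qed.

Lemma cont01_comp g h : continuity g -> cont01 h -> cont01 (fun x => g (h x)).
Proof.
intros Hg Hh x Hx eps Heps. destruct (Hg (h x) eps Heps) as [d [Hd Hc]].
destruct (Hh x Hx d Hd) as [e [He Hc']].
exists e. split; [exact He|]. intros y Hy. specialize (Hc' y Hy).
destruct (Req_dec (h x) (h y)) as [E|Hne].
- simpl. unfold Rdist. rewrite E, Rminus_diag, Rabs_R0. exact Heps.
- apply Hc. split; [split; [exact I|exact Hne]|exact Hc'].
Qed.

Lemma cont01_plus h k : cont01 h -> cont01 k -> cont01 (fun x => h x + k x).
Proof. intros H K x Hx. apply limit_plus; [apply H, Hx|apply K, Hx]. Qed.

Lemma cont01_minus h k : cont01 h -> cont01 k -> cont01 (fun x => h x - k x).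
Proof. intros H K x Hx. apply limit_minus; [apply H, Hx|apply K, Hx]. Qed.

Lemma cont01_mult h k : cont01 h -> cont01 k -> cont01 (fun x => h x * k x).
Proof. intros H K x Hx. apply limit_mul; [apply H, Hx|apply K, Hx]. Qed.

Lemma cont01_const c : cont01 (fun _ => c).
Proof.
apply cont01_pt. intros x _. apply continuity_pt_const. intros ? ?; reflexivity.
Qed.

Lemma cont01_pow N : cont01 (fun x => x ^ N).
Proof.
apply cont01_pt. intros x _. apply derivable_continuous_pt, derivable_pt_pow.
Qed.

(** Constant extension beyond the endpoints turns continuity relative to [[0, 1]] into continuity on
    the line, the form in which the intermediate and mean value theorems are applied. *)
Lemma cont01_clip h : cont01 h -> continuity (fun x => h (clip 0 1 x)).
Proof.
intros Hh x eps Heps.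
destruct (Hh (clip 0 1 x)) with eps as [d [Hd Hc]];
  [apply clip_range; lra|exact Heps|].
exists d. split; [exact Hd|]. intros y [_ Hy]. apply Hc.
split; [apply clip_range; lra|].
simpl in *. unfold Rdist in *. eapply Rle_lt_trans; [apply clip_lipschitz|exact Hy].
Qed.

Lemma derivable_limit01 u l x : derivable_pt_lim u x l ->
  limit1_in (fun y => (u y - u x) / (y - x)) (fun y => 0 <= y <= 1 /\ y <> x) l x.
Proof.
intros H eps Heps. destruct (H eps Heps) as [d Hd].
exists d. split; [apply cond_pos|]. intros y [[_ Hne] Hy].
simpl in *. unfold Rdist in *.
specialize (Hd (y - x)). replace (x + (y - x)) with y in Hd by ring.
apply Hd; lra.
Qed.

Lemma deriv01_interior u u' x :
  deriv01 u u' -> 0 < x < 1 -> derivable_pt_lim u x (u' x).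
Proof.
intros H Hx eps Heps.
destruct (H x) with eps as [d [Hd Hc]]; [lra|exact Heps|].
assert (Hm : 0 < Rmin d (Rmin x (1 - x))) by (repeat apply Rmin_pos; lra).
exists (mkposreal _ Hm). simpl. intros h Hh Hhm.
assert (H1 : Rabs h < d) by (eapply Rlt_le_trans; [exact Hhm|apply Rmin_l]).
assert (H2 : Rabs h < Rmin x (1 - x)) by (eapply Rlt_le_trans; [exact Hhm|apply Rmin_r]).
pose proof (Rmin_l x (1 - x)). pose proof (Rmin_r x (1 - x)).
apply Rabs_def2 in H2.
specialize (Hc (x + h)). simpl in Hc. unfold Rdist in Hc.
replace (x + h - x) with h in Hc by ring. apply Hc. split; [split; lra|exact H1].
Qed.

Lemma deriv01_cont01 u u' : deriv01 u u' -> cont01 u.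
Proof.
intros H x Hx eps Heps.
destruct (H x Hx 1 Rlt_0_1) as [d [Hd Hc]].
pose (K := Rabs (u' x) + 1).
assert (HK : 0 < K) by (unfold K; generalize (Rabs_pos (u' x)); lra).
exists (Rmin d (eps / K)). split.
{ apply Rmin_pos; [exact Hd|]. apply Rdiv_lt_0_compat; assumption. }
simpl in *. unfold Rdist in *. intros y [Hy Hyx].
destruct (Req_dec y x) as [->|Hne]; [rewrite Rminus_diag, Rabs_R0; exact Heps|].
specialize (Hc y). assert (Hq : Rabs ((u y - u x) / (y - x)) < K).
{ replace ((u y - u x) / (y - x)) with ((u y - u x) / (y - x) - u' x + u' x) by ring.
  eapply Rle_lt_trans; [apply Rabs_triang|].
  assert (Rabs ((u y - u x) / (y - x) - u' x) < 1); [|unfold K; lra].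
  apply Hc. split; [auto|]. eapply Rlt_le_trans; [exact Hyx|apply Rmin_l]. }
replace (u y - u x) with ((u y - u x) / (y - x) * (y - x)) by (field; lra).
rewrite Rabs_mult.
assert (0 < Rabs (y - x)) by (apply Rabs_pos_lt; lra).
apply Rlt_le_trans with (K * (eps / K)); [|right; field; lra].
apply Rle_lt_trans with (K * Rabs (y - x)); [nra|].
apply Rmult_lt_compat_l; [exact HK|].
eapply Rlt_le_trans; [exact Hyx|apply Rmin_r].
Qed.

Lemma derivable_ext01 h k r l :
  (forall z, 0 < z < 1 -> h z = k z) -> 0 < r < 1 ->
  derivable_pt_lim h r l -> derivable_pt_lim k r l.
Proof.
intros Hhk Hr Hd. apply is_derive_Reals.
apply is_derive_ext_loc with h; [|apply is_derive_Reals, Hd].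
assert (Hm : 0 < Rmin r (1 - r)) by (apply Rmin_pos; lra).
exists (mkposreal _ Hm). intros z Hz.
unfold ball in Hz; simpl in Hz.
unfold AbsRing_ball, abs, minus, plus, opp in Hz; simpl in Hz.
pose proof (Rmin_l r (1 - r)). pose proof (Rmin_r r (1 - r)).
apply Rabs_def2 in Hz. apply Hhk. lra.
Qed.

Lemma MVT01 (h h' : R -> R) x y :
  cont01 h -> (forall r, 0 < r < 1 -> derivable_pt_lim h r (h' r)) ->
  0 <= x -> x < y -> y <= 1 -> exists c, x < c < y /\ h y - h x = h' c * (y - x).
Proof.
intros Hc Hd Hx Hxy Hy.
set (k := fun r => h (clip 0 1 r)).
assert (Hk : forall r, 0 < r < 1 -> derivable_pt_lim k r (h' r)).
{ intros r Hr. apply (derivable_ext01 h); auto.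
  intros z Hz. unfold k. rewrite clip_id; [reflexivity|lra]. }
assert (pr1 : forall c, x < c < y -> derivable_pt k c).
{ intros c Hcxy. exists (h' c). apply Hk. lra. }
assert (pr2 : forall c, x < c < y -> derivable_pt id c) by (intros; apply derivable_pt_id).
destruct (MVT k id x y pr1 pr2 Hxy) as [c [P E]].
- intros; apply (cont01_clip h Hc).
- intros; apply derivable_continuous_pt, derivable_pt_id.
- exists c. split; [exact P|].
  rewrite (derive_pt_eq_0 k c (h' c)) in E by (apply Hk; lra).
  rewrite (derive_pt_eq_0 id c 1) in E by apply derivable_pt_lim_id.
  unfold k, id in E. rewrite !clip_id in E by lra. lra.
Qed.

Lemma nondecreasing01 (h h' : R -> R) x y :
  cont01 h -> (forall r, 0 < r < 1 -> derivable_pt_lim h r (h' r)) ->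
  (forall r, x < r < y -> 0 <= h' r) ->
  0 <= x -> x <= y -> y <= 1 -> h x <= h y.
Proof.
intros Hc Hd Hp Hx [Hxy|<-] Hy; [|lra].
destruct (MVT01 h h' x y Hc Hd Hx Hxy Hy) as [c [Hcc E]].
specialize (Hp c Hcc). nra.
Qed.

Lemma increasing01 (h h' : R -> R) x y :
  cont01 h -> (forall r, 0 < r < 1 -> derivable_pt_lim h r (h' r)) ->
  (forall r, x < r < y -> 0 < h' r) ->
  0 <= x -> x < y -> y <= 1 -> h x < h y.
Proof.
intros Hc Hd Hp Hx Hxy Hy.
destruct (MVT01 h h' x y Hc Hd Hx Hxy Hy) as [c [Hcc E]].
specialize (Hp c Hcc). nra.
Qed.

Lemma derivable_pt_lim_scal_pow k N r :
  derivable_pt_lim (fun s => k * s ^ N) r (INR N * r ^ (N - 1) * k).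
Proof.
replace (INR N * r ^ (N - 1) * k) with (k * (INR N * r ^ pred N))
  by (rewrite <- Nat.sub_1_r; ring).
apply (derivable_pt_lim_scal (fun s => s ^ N)), derivable_pt_lim_pow.
Qed.

(** * The radial eigenfunction *)

(** [B] stands for (-phi')^N. The last clause makes any term [C * r ^ N] a multiple of [B], which is
    how the additive constant is absorbed. *)
Definition eigen_profile (N : nat) (lam1 b : R) (phi B : R -> R) : Prop :=
  cont01 phi /\ cont01 B /\ B 0 = 0 /\ phi 1 = 0 /\
  (forall r, 0 < r < 1 -> 0 < phi r) /\
  (forall r, 0 < r < 1 -> derivable_pt_lim phi r (- nroot N (B r))) /\
  (forall r, 0 < r < 1 ->
     derivable_pt_lim B r (lam1 ^ N * INR N * r ^ (N - 1) * phi r ^ N)) /\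
  (forall r, 0 <= r <= 1 -> b * r ^ N <= B r).

(* The equation only determines [(- phi')^N]; for even [N] the sign of [phi']
   comes from the boundary condition [phi 1 = 0] and the absence of interior
   zeros of [phi']. *)
Lemma eigenfunction_profile N lam1 phi :
  (1 <= N)%nat -> 0 < lam1 -> pos_eigenfunction N lam1 phi ->
  exists B b, 0 < b /\ eigen_profile N lam1 b phi B.
Proof.
intros HN Hl [phi1 [phi2 [[D1 [D2 _]] [H0 [H1 [Hpos Heq]]]]]].
pose proof (deriv01_cont01 _ _ D1) as C0.
pose proof (deriv01_cont01 _ _ D2) as C1.
set (B := fun s => (- phi1 s) ^ N).
assert (CB : cont01 B).
{ apply (cont01_comp (fun x => (- x) ^ N)); [|exact C1].
  apply (continuity_comp Ropp (fun x => x ^ N)); [apply continuity_Ropp|].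
  apply derivable_continuous, derivable_pow. }
assert (HB0 : B 0 = 0).
{ unfold B. rewrite H0, Ropp_0. apply pow_i. lia. }
assert (HNpos : 0 < INR N) by (apply lt_0_INR; lia).
assert (HBpos : forall r, 0 < r <= 1 -> 0 < B r).
{ intros r Hr. rewrite <- HB0.
  apply (increasing01 B _ 0 r CB Heq); try lra.
  intros s Hs. repeat apply Rmult_lt_0_compat; try apply pow_lt; try lra.
  apply Hpos; lra. }
assert (Hsgn : forall r, 0 < r <= 1 -> phi1 r < 0).
{ intros r Hr. apply Rnot_le_lt. intros Hge.
  assert (Hnz : forall s, 0 < s <= 1 -> phi1 s <> 0).
  { intros s Hs E. generalize (HBpos s Hs). unfold B.
    rewrite E, Ropp_0, pow_i by lia. lra. }
  assert (Hall : forall s, 0 < s <= 1 -> 0 < phi1 s).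
  { intros s Hs. apply Rnot_le_lt. intros Hle.
    destruct (IVT_cor (fun x => phi1 (clip 0 1 x)) (Rmin r s) (Rmax r s)) as [z [Hz Ez]].
    - apply cont01_clip, C1.
    - apply Rle_trans with r; [apply Rmin_l|apply Rmax_l].
    - destruct (Rle_dec r s) as [Hrs|Hrs].
      + rewrite Rmin_left, Rmax_right, !clip_id by lra. nra.
      + rewrite Rmin_right, Rmax_left, !clip_id by lra. nra.
    - assert (0 < Rmin r s) by (apply Rmin_glb_lt; lra).
      assert (Rmax r s <= 1) by (apply Rmax_lub; lra).
      rewrite clip_id in Ez by lra. apply (Hnz z); [lra|exact Ez]. }
  assert (phi (1/2) < phi 1).
  { apply (increasing01 phi phi1 (1/2) 1 C0); try lra.
    - intros x Hx. apply (deriv01_interior _ _ _ D1 Hx).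
    - intros x Hx. apply Hall; lra. }
  generalize (Hpos (1/2)). lra. }
assert (Hroot : forall r, 0 < r <= 1 -> nroot N (B r) = - phi1 r).
{ intros r Hr. apply nroot_eq; [exact HN| |reflexivity]. generalize (Hsgn r Hr); lra. }
assert (Hdphi : forall r, 0 < r < 1 -> derivable_pt_lim phi r (- nroot N (B r))).
{ intros r Hr. rewrite Hroot, Ropp_involutive by lra.
  apply (deriv01_interior _ _ _ D1 Hr). }
set (m := phi (1/2)).
assert (Hm : 0 < m) by (apply Hpos; lra).
assert (HBlow : forall r, 0 <= r <= 1/2 -> (lam1 * m) ^ N * r ^ N <= B r).
{ intros r Hr.
  assert (B 0 - (lam1 * m) ^ N * 0 ^ N <= B r - (lam1 * m) ^ N * r ^ N).
  { apply (nondecreasing01 (fun s => B s - (lam1 * m) ^ N * s ^ N)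
      (fun s => lam1 ^ N * INR N * s ^ (N - 1) * phi s ^ N
                - INR N * s ^ (N - 1) * (lam1 * m) ^ N)); try lra.
    - apply cont01_minus; [exact CB|].
      apply cont01_mult; [apply cont01_const|apply cont01_pow].
    - intros s Hs. apply derivable_pt_lim_minus; [apply Heq, Hs|].
      apply derivable_pt_lim_scal_pow.
    - intros s Hs. rewrite Rpow_mult_distr.
      assert (m <= phi s).
      { assert (- phi s <= - phi (1/2)); [|unfold m; lra].
        apply (nondecreasing01 (fun x => - phi x) (fun x => - phi1 x)); try lra.
        - apply (cont01_comp Ropp); [apply continuity_Ropp|exact C0].
        - intros x Hx. apply derivable_pt_lim_opp, (deriv01_interior _ _ _ D1 Hx).
        - intros x Hx. assert (phi1 x < 0) by (apply Hsgn; lra). lra. }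
      assert (m ^ N <= phi s ^ N) by (apply pow_incr; lra).
      assert (0 <= lam1 ^ N * INR N * s ^ (N - 1)).
      { repeat apply Rmult_le_pos; try apply pow_le; lra. }
      nra. }
  rewrite HB0, pow_i in H by lia. lra. }
(* On [[0, 1/2]] one has [phi >= m], which gives the constant [(lam1 * m) ^ N]. Beyond [1/2] only
   the monotonicity of [B] is used, and [(1/2) ^ N] is lost. *)
exists B, ((lam1 * m / 2) ^ N). split.
{ apply pow_lt. assert (0 < lam1 * m) by (apply Rmult_lt_0_compat; lra). lra. }
repeat split; auto.
assert (Hlm : 0 < lam1 * m) by (apply Rmult_lt_0_compat; lra).
intros r Hr. destruct (Rle_dec r (1/2)) as [Hr2|Hr2].
- eapply Rle_trans; [|apply HBlow; lra].
  apply Rmult_le_compat_r; [apply pow_le; lra|]. apply pow_incr. lra.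
- apply Rle_trans with (B (1/2)).
  + eapply Rle_trans; [|apply HBlow; lra].
    rewrite <- !Rpow_mult_distr. apply pow_incr. nra.
  + apply (nondecreasing01 B _ (1/2) r CB Heq); try lra.
    intros s Hs. repeat apply Rmult_le_pos; try apply pow_le; try lra.
    left; apply Hpos; lra.
Qed.

(** * Radial solutions *)

(** [h] absorbs the factor lam^N. Cutting [V] at 0 keeps [A] nondecreasing even if [V] becomes
    negative before [r = 1]; the cut is invisible once [V 1 = 0]. *)
Definition radial_sol (N : nat) (h : R -> R) (V A : R -> R) : Prop :=
  A 0 = 0 /\ forall r, 0 <= r <= 1 ->
    derivable_pt_lim V r (- nroot N (A r)) /\
    derivable_pt_lim A r (INR N * r ^ (N - 1) * h (Rmax 0 (V r))).

Section Radial.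

Variables (N : nat) (h : R -> R).
Hypotheses (HN : (1 <= N)%nat) (h_ge0 : forall s, 0 <= s -> 0 <= h s).

Section Properties.

Variables (V A : R -> R).
Hypothesis HVA : radial_sol N h V A.

Lemma radial_cont_V : cont01 V.
Proof.
apply cont01_pt. intros x Hx. apply derivable_continuous_pt.
eexists. apply (proj2 HVA x Hx).
Qed.

Lemma radial_cont_A : cont01 A.
Proof.
apply cont01_pt. intros x Hx. apply derivable_continuous_pt.
eexists. apply (proj2 HVA x Hx).
Qed.

Lemma radial_dV r : 0 < r < 1 -> derivable_pt_lim V r (- nroot N (A r)).
Proof. intros Hr. apply (proj2 HVA). lra. Qed.

Lemma radial_dA r :
  0 < r < 1 -> derivable_pt_lim A r (INR N * r ^ (N - 1) * h (Rmax 0 (V r))).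
Proof. intros Hr. apply (proj2 HVA). lra. Qed.

Lemma radial_A_upper (H H' : R -> R) x :
  cont01 H -> H 0 = 0 -> (forall r, 0 < r < 1 -> derivable_pt_lim H r (H' r)) ->
  x <= 1 -> (forall r, 0 < r < x -> INR N * r ^ (N - 1) * h (Rmax 0 (V r)) <= H' r) ->
  forall r, 0 <= r <= x -> A r <= H r.
Proof.
intros CH H0 DH Hx Hle r Hr.
assert (H 0 - A 0 <= H r - A r).
{ apply (nondecreasing01 (fun s => H s - A s)
    (fun s => H' s - INR N * s ^ (N - 1) * h (Rmax 0 (V s)))); try lra.
  - apply cont01_minus; [exact CH|apply radial_cont_A].
  - intros s Hs. apply derivable_pt_lim_minus; [apply DH, Hs|apply radial_dA, Hs].
  - intros s Hs. assert (Hs' : 0 < s < x) by lra. specialize (Hle s Hs'). lra. }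
rewrite H0, (proj1 HVA) in H1. lra.
Qed.

Lemma radial_A_lower (k x : R) :
  x <= 1 -> (forall r, 0 < r < x -> k <= h (Rmax 0 (V r))) ->
  forall r, 0 <= r <= x -> k * r ^ N <= A r.
Proof.
intros Hx Hk r Hr.
assert (A 0 - k * 0 ^ N <= A r - k * r ^ N).
{ apply (nondecreasing01 (fun s => A s - k * s ^ N)
    (fun s => INR N * s ^ (N - 1) * h (Rmax 0 (V s)) - INR N * s ^ (N - 1) * k)); try lra.
  - apply cont01_minus; [apply radial_cont_A|].
    apply cont01_mult; [apply cont01_const|apply cont01_pow].
  - intros s Hs. apply derivable_pt_lim_minus; [apply radial_dA, Hs|].
    apply derivable_pt_lim_scal_pow.
  - intros s Hs. assert (k <= h (Rmax 0 (V s))) by (apply Hk; lra).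
    assert (0 <= INR N * s ^ (N - 1)).
    { apply Rmult_le_pos; [apply pos_INR|apply pow_le; lra]. }
    nra. }
rewrite (proj1 HVA), pow_i in H by lia. lra.
Qed.

Lemma radial_A_mono x y : 0 <= x -> x <= y -> y <= 1 -> A x <= A y.
Proof.
intros Hx Hxy Hy.
apply (nondecreasing01 A _ x y radial_cont_A radial_dA); try lra.
intros r Hr. apply Rmult_le_pos; [|apply h_ge0, Rmax_l].
apply Rmult_le_pos; [apply pos_INR|apply pow_le; lra].
Qed.

Lemma radial_A_ge0 r : 0 <= r <= 1 -> 0 <= A r.
Proof. intros Hr. rewrite <- (proj1 HVA). apply radial_A_mono; lra. Qed.

Lemma radial_V_noninc x y : 0 <= x -> x <= y -> y <= 1 -> V y <= V x.
Proof.
intros Hx [Hxy|<-] Hy; [|lra].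
destruct (MVT01 V _ x y radial_cont_V radial_dV) as [c [Hc E]]; try lra.
pose proof (nroot_ge0 N (A c)). nra.
Qed.

(** Suppose [V 1 >= 0]. The slope steepens with [r], so at most half of [V 0] is lost by [r = 1/2],
    and there [h (V r) >= (8 * V 0) ^ N]. Hence [A (1/2) >= (4 * V 0) ^ N], and [V] drops by at
    least [2 * V 0] on the second half, which is impossible. *)
Lemma radial_small_shot :
  0 < V 0 -> (forall s, 0 < s <= V 0 -> (16 * s) ^ N <= h s) -> V 1 < 0.
Proof.
intros Hd Hh. apply Rnot_le_lt. intros HV1.
destruct (MVT01 V _ 0 (1/2) radial_cont_V radial_dV) as [c1 [Hc1 E1]]; try lra.
destruct (MVT01 V _ (1/2) 1 radial_cont_V radial_dV) as [c2 [Hc2 E2]]; try lra.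
assert (A12 : nroot N (A c1) <= nroot N (A (1/2)) <= nroot N (A c2)).
{ split; (apply nroot_le; [exact HN|apply radial_A_ge0; lra|apply radial_A_mono; lra]). }
assert (Hhalf : V 0 / 2 <= V (1/2)) by lra.
assert (HA : (8 * V 0) ^ N * (1/2) ^ N <= A (1/2)).
{ apply (radial_A_lower _ (1/2)); try lra.
  intros r Hr.
  assert (V (1/2) <= V r) by (apply radial_V_noninc; lra).
  assert (V r <= V 0) by (apply radial_V_noninc; lra).
  rewrite Rmax_right by lra.
  eapply Rle_trans; [|apply Hh; lra]. apply pow_incr. lra. }
rewrite <- Rpow_mult_distr in HA.
assert (4 * V 0 <= nroot N (A (1/2))).
{ rewrite <- (nroot_eq N ((8 * V 0 * (1/2)) ^ N) (4 * V 0)); [|exact HN|lra|f_equal; field].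
  apply nroot_le; [exact HN|apply radial_A_ge0; lra|exact HA]. }
assert (V (1/2) <= V 0) by (apply radial_V_noninc; lra).
lra.
Qed.

(** * Comparison of large shots with the eigenfunction *)

Section Comparison.

Variables (lam1 b nu C : R) (phi B : R -> R).
Hypotheses (Hb : 0 < b) (Hphi : eigen_profile N lam1 b phi B)
  (Hnu : 0 < nu < lam1) (HC : 0 <= C)
  (h_upper : forall s, 0 <= s -> h s <= (nu * s) ^ N + C) (HV1 : V 1 <= 0).

(** Taking roots in [A <= k * B] compares the slopes, so [V - nroot N k * phi] is nondecreasing; its
    value at 1 is [V 1 <= 0]. *)
Lemma radial_V_le k :
  0 <= k -> (forall r, 0 <= r <= 1 -> A r <= k * B r) ->
  forall r, 0 <= r <= 1 -> V r <= nroot N k * phi r.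
Proof.
destruct Hphi as [Cphi [CB [HB0 [Hphi1 [Hpos [Dphi [DB Hlow]]]]]]].
intros Hk HAB r Hr.
assert (HBge0 : forall s, 0 <= s <= 1 -> 0 <= B s).
{ intros s Hs. eapply Rle_trans; [|apply Hlow, Hs].
  apply Rmult_le_pos; [lra|apply pow_le; lra]. }
assert (V r - nroot N k * phi r <= V 1 - nroot N k * phi 1).
{ apply (nondecreasing01 (fun s => V s - nroot N k * phi s)
    (fun s => - nroot N (A s) - nroot N k * (- nroot N (B s)))); try lra.
  - apply cont01_minus; [apply radial_cont_V|].
    apply cont01_mult; [apply cont01_const|exact Cphi].
  - intros s Hs. apply derivable_pt_lim_minus; [apply radial_dV, Hs|].
    apply derivable_pt_lim_scal, Dphi, Hs.
  - intros s Hs.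
    assert (nroot N (A s) <= nroot N (k * B s)).
    { apply nroot_le; [exact HN| |apply HAB; lra].
      apply Rmult_le_pos; [exact Hk|apply HBge0; lra]. }
    rewrite nroot_mult in H; auto; [lra|]. apply HBge0; lra. }
rewrite Hphi1 in H. lra.
Qed.

(** The gain per step: [(nu * c * phi) ^ N] is [q * c ^ N] times the source term [(lam1 * phi) ^ N]
    of [B]. *)
Let q := (nu / lam1) ^ N.

Lemma ratio_lt1 : 0 <= q < 1.
Proof.
split.
- apply pow_le. apply Rlt_le, Rdiv_lt_0_compat; lra.
- unfold q. rewrite <- (pow1 N). apply pow_lt_mono; [exact HN|].
  split; [apply Rlt_le, Rdiv_lt_0_compat; lra|]. apply Rlt_div_l; lra.
Qed.

(* A bound [V <= c phi] with [c] large improves itself by the factor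
   [nroot N ((1 + q) / 2) < 1]. *)
Lemma radial_contract c0 c :
  0 < c0 -> C <= (1 - q) / 2 * c0 ^ N * b -> c0 <= c ->
  (forall r, 0 <= r <= 1 -> V r <= c * phi r) ->
  forall r, 0 <= r <= 1 -> V r <= nroot N ((1 + q) / 2) * c * phi r.
Proof.
pose proof ratio_lt1 as Hq.
destruct Hphi as [Cphi [CB [HB0 [Hphi1 [Hpos [Dphi [DB Hlow]]]]]]].
intros Hc0 HCc Hc HV.
assert (Hcc : c0 ^ N <= c ^ N) by (apply pow_incr; lra).
assert (HcN : 0 < c0 ^ N) by (apply pow_lt, Hc0).
rewrite <- (nroot_eq N (c ^ N) c) by (auto; lra).
rewrite <- nroot_mult by (auto; lra).
apply radial_V_le; [nra|].
intros r Hr.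
apply Rle_trans with (q * c ^ N * B r + C * r ^ N).
- apply (radial_A_upper (fun s => q * c ^ N * B s + C * s ^ N)
    (fun s => q * c ^ N * (lam1 ^ N * INR N * s ^ (N - 1) * phi s ^ N)
              + INR N * s ^ (N - 1) * C) 1); auto using Rle_refl.
  + apply cont01_plus; apply cont01_mult; auto using cont01_const, cont01_pow.
  + rewrite HB0, pow_i by lia. ring.
  + intros s Hs. apply derivable_pt_lim_plus; [|apply derivable_pt_lim_scal_pow].
    apply derivable_pt_lim_scal, DB, Hs.
  + intros s Hs.
    assert (Hs0 : 0 <= INR N * s ^ (N - 1)).
    { apply Rmult_le_pos; [apply pos_INR|apply pow_le; lra]. }
    assert (Hh : h (Rmax 0 (V s)) <= (nu * (c * phi s)) ^ N + C).
    { eapply Rle_trans; [apply h_upper, Rmax_l|].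
      apply Rplus_le_compat_r, pow_incr. split.
      - apply Rmult_le_pos; [lra|apply Rmax_l].
      - apply Rmult_le_compat_l; [lra|]. apply Rmax_lub; [|apply HV; lra].
        apply Rmult_le_pos; [lra|]. left; apply Hpos, Hs. }
    replace (nu * (c * phi s)) with (nu / lam1 * c * lam1 * phi s) in Hh
      by (field; lra).
    rewrite !Rpow_mult_distr in Hh. fold q in Hh.
    apply Rle_trans with (INR N * s ^ (N - 1) * (q * c ^ N * lam1 ^ N * phi s ^ N + C)).
    * apply Rmult_le_compat_l; assumption.
    * right. ring.
- assert (HrN : 0 <= r ^ N) by (apply pow_le; lra).
  specialize (Hlow r Hr).
  assert (C * r ^ N <= (1 - q) / 2 * c ^ N * (b * r ^ N)).
  { rewrite <- Rmult_assoc. apply Rmult_le_compat_r; [exact HrN|].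
    eapply Rle_trans; [exact HCc|]. apply Rmult_le_compat_r; [lra|].
    apply Rmult_le_compat_l; lra. }
  assert ((1 - q) / 2 * c ^ N * (b * r ^ N) <= (1 - q) / 2 * c ^ N * B r).
  { apply Rmult_le_compat_l; [|exact Hlow]. nra. }
  nra.
Qed.

(** A first bound [V <= c * phi] comes from [V <= V 0], with [c] depending on [V 0]. Contraction by
    [t < 1] is repeated until the factor reaches [c0], which no longer depends on [V 0]. *)
Lemma radial_large_shot c0 :
  0 < c0 -> C <= (1 - q) / 2 * c0 ^ N * b -> 0 <= V 0 -> V 0 <= c0 * phi 0.
Proof.
pose proof ratio_lt1 as Hq. pose proof Hphi as Hphi'.
destruct Hphi' as [Cphi [CB [HB0 [Hphi1 [Hpos [Dphi [DB Hlow]]]]]]].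
intros Hc0 HCc HV0.
set (S := (nu * V 0) ^ N + C).
assert (HS : 0 <= S) by (assert (0 <= (nu * V 0) ^ N) by (apply pow_le; nra); unfold S; lra).
assert (HSb : 0 <= S / b) by (apply Rmult_le_pos; [lra|left; apply Rinv_0_lt_compat, Hb]).
assert (Hinit : forall r, 0 <= r <= 1 -> V r <= nroot N (S / b) * phi r).
{ apply radial_V_le; [exact HSb|].
  intros r Hr. apply Rle_trans with (S * r ^ N).
  - apply (radial_A_upper (fun s => S * s ^ N) (fun s => INR N * s ^ (N - 1) * S) 1); auto using Rle_refl.
    + apply cont01_mult; [apply cont01_const|apply cont01_pow].
    + rewrite pow_i by lia. ring.
    + intros s _. apply derivable_pt_lim_scal_pow.
    + intros s Hs. apply Rmult_le_compat_l.
      * apply Rmult_le_pos; [apply pos_INR|apply pow_le; lra].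
      * eapply Rle_trans; [apply h_upper, Rmax_l|].
        apply Rplus_le_compat_r, pow_incr. split.
        -- apply Rmult_le_pos; [lra|apply Rmax_l].
        -- apply Rmult_le_compat_l; [lra|]. apply Rmax_lub; [exact HV0|].
           apply radial_V_noninc; lra.
  - apply Rle_trans with (S / b * (b * r ^ N)); [right; field; lra|].
    apply Rmult_le_compat_l; [exact HSb|apply Hlow, Hr]. }
set (t := nroot N ((1 + q) / 2)). set (c := nroot N (S / b)) in *.
assert (Ht : 0 <= t < 1).
{ split; [apply nroot_ge0|]. rewrite <- (nroot_eq N 1 1); [|exact HN|lra|apply pow1].
  apply nroot_lt; [exact HN|lra]. }
assert (Hphi_ge0 : forall r, 0 <= r <= 1 -> 0 <= phi r).
{ intros r Hr. rewrite <- Hphi1.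
  assert (- phi r <= - phi 1); [|lra].
  apply (nondecreasing01 (fun x => - phi x) (fun x => - - nroot N (B x))); try lra.
  - apply (cont01_comp Ropp); [apply continuity_Ropp|exact Cphi].
  - intros x Hx. apply derivable_pt_lim_opp, Dphi, Hx.
  - intros x _. rewrite Ropp_involutive. apply nroot_ge0. }
assert (Hiter : forall n r, 0 <= r <= 1 -> V r <= Rmax c0 (t ^ n * c) * phi r).
{ induction n as [|n IH]; intros r Hr.
  - eapply Rle_trans; [apply Hinit, Hr|].
    apply Rmult_le_compat_r; [apply Hphi_ge0, Hr|].
    simpl. rewrite Rmult_1_l. apply Rmax_r.
  - eapply Rle_trans; [apply (radial_contract c0 _ Hc0 HCc (Rmax_l _ _) IH r Hr)|].
    apply Rmult_le_compat_r; [apply Hphi_ge0, Hr|]. fold t.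
    rewrite <- RmaxRmult by lra. simpl.
    apply Rmax_lub; [|rewrite Rmult_assoc; apply Rmax_r].
    eapply Rle_trans; [|apply Rmax_l]. nra. }
(* [c + 1] because [c] may vanish. *)
destruct (pow_lt_1_zero t) with (y := c0 / (c + 1)) as [n Hn].
- rewrite Rabs_pos_eq; lra.
- apply Rdiv_lt_0_compat; [exact Hc0|]. generalize (nroot_ge0 N (S / b)). fold c. lra.
- specialize (Hn n (Nat.le_refl n)). specialize (Hiter n 0).
  assert (Hc : 0 <= c) by apply nroot_ge0.
  rewrite Rabs_pos_eq in Hn by (apply pow_le; lra).
  rewrite Rmax_left in Hiter; [apply Hiter; lra|].
  apply Rle_trans with (c0 / (c + 1) * (c + 1)); [|right; field; lra].
  assert (0 <= t ^ n) by (apply pow_le; lra).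
  apply Rmult_le_compat; lra.
Qed.

End Comparison.
End Properties.

(** * Existence of a radial solution *)

(** [shooting] wants coefficients bounded on the whole line, so all three are clipped; a solution
    starting at or below [D] never reaches the clipping levels on [[0, 1]], apart from the cut at 0
    already present in [radial_sol]. *)
Lemma radial_exists lam1 b nu C phi B d0 :
  continuity h -> 0 < b -> eigen_profile N lam1 b phi B -> 0 < nu < lam1 -> 0 <= C ->
  (forall s, 0 <= s -> h s <= (nu * s) ^ N + C) ->
  0 < d0 -> (forall s, 0 < s <= d0 -> (16 * s) ^ N <= h s) ->
  exists V A, radial_sol N h V A /\ 0 < V 0 /\ V 1 = 0.
Proof.
intros Hh Hb Hphi Hnu HC Hup Hd0 Hlow.
pose proof (ratio_lt1 lam1 nu Hnu) as Hq.
set (q := (nu / lam1) ^ N) in *.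
set (K := (1 - q) / 2 * b).
assert (HK : 0 < K) by (unfold K; nra).
(* The root ensures [K * c0 ^ N >= C]; the added 1 keeps [c0] positive when [C = 0]. *)
set (c0 := nroot N (C / K) + 1).
assert (Hc0 : 0 < c0) by (unfold c0; generalize (nroot_ge0 N (C / K)); lra).
assert (HCK : 0 <= C / K) by (apply Rmult_le_pos; [lra|left; apply Rinv_0_lt_compat, HK]).
assert (HCc : C <= (1 - q) / 2 * c0 ^ N * b).
{ replace ((1 - q) / 2 * c0 ^ N * b) with (K * c0 ^ N) by (unfold K; ring).
  apply Rle_trans with (K * (C / K)); [right; field; lra|].
  apply Rmult_le_compat_l; [lra|]. rewrite <- (pow_nroot N (C / K) HN HCK).
  apply pow_incr. split; [apply nroot_ge0|unfold c0; lra]. }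
(* Starting above [c0 * phi 0] excludes [V 1 <= 0], by [radial_large_shot]. *)
set (D := Rmax d0 (c0 * phi 0) + 1).
assert (HD : d0 < D /\ c0 * phi 0 < D).
{ unfold D. generalize (Rmax_l d0 (c0 * phi 0)) (Rmax_r d0 (c0 * phi 0)). lra. }
set (a := fun r => INR N * clip 0 1 r ^ (N - 1)).
set (g := fun s => h (clip 0 D s)).
assert (ca0 : continuity (fun r => INR N * r ^ (N - 1))).
{ apply (continuity_scal (fun r => r ^ (N - 1))), derivable_continuous, derivable_pow. }
assert (ca : continuity a) by exact (continuity_comp _ _ (clip_continuity 0 1) ca0).
assert (cg : continuity g) by exact (continuity_comp _ _ (clip_continuity 0 D) Hh).
destruct (continuity_clip_bounded _ 0 1 ca0) as [Ma [HMa Ba]]; [lra|].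
destruct (continuity_clip_bounded h 0 D Hh) as [Mg [HMg Bg]]; [lra|].
set (M := Ma * Mg).
assert (HM : 0 <= M) by (apply Rmult_le_pos; assumption).
set (G := fun x => nroot N (clip 0 M x)).
assert (cG : continuity G)
  by exact (continuity_comp _ _ (clip_continuity 0 M) (nroot_continuity N HN)).
destruct (continuity_clip_bounded (nroot N) 0 M (nroot_continuity N HN) HM)
  as [MG [HMG BG]].
set (L := MG + Ma + Mg).
assert (Hrad : forall V A, shoot_sol G a g V A -> V 0 <= D -> radial_sol N h V A).
{ intros V A [HA0 Hsol] HVD.
  (* This follows from the bounds on the clipped [a] and [g] alone, before [V r <= D] is known. *)
  assert (HA : forall r, 0 <= r <= 1 -> 0 <= A r <= M).
  { intros r [[Hr0|<-] Hr1]; [|lra].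
    destruct (MVT_cor2 A (fun r => a r * g (V r)) 0 r Hr0) as [c [E Hc]].
    { intros c Hc. apply Hsol. lra. }
    rewrite HA0 in E.
    assert (0 <= a c <= Ma).
    { split; [|eapply Rle_trans; [apply Rle_abs|apply Ba]].
      apply Rmult_le_pos; [apply pos_INR|apply pow_le; apply clip_range; lra]. }
    assert (0 <= g (V c) <= Mg).
    { split; [apply h_ge0, clip_range; lra|eapply Rle_trans; [apply Rle_abs|apply Bg]]. }
    assert (0 <= a c * g (V c) <= M) by (unfold M; split; nra).
    nra. }
  split; [exact HA0|]. intros r Hr. destruct (Hsol r) as [H1 H2]; [lra|].
  unfold G in H1. rewrite clip_id in H1 by (apply HA, Hr).
  split; [exact H1|].
  unfold a, g in H2. rewrite clip_id in H2 by exact Hr.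
  assert (HVr : V r <= D).
  { destruct Hr as [[Hr0|<-] Hr1]; [|exact HVD].
    destruct (MVT_cor2 V (fun r => - G (A r)) 0 r Hr0) as [c [E Hc]].
    { intros c Hc. apply Hsol. lra. }
    assert (0 <= G (A c)) by apply nroot_ge0. nra. }
  unfold clip in H2. rewrite Rmin_left in H2 by exact HVr. exact H2. }
destruct (shooting G a g L cG ca cg) with d0 D as [V [A [Hs [HV0 HV1]]]].
- intros x. eapply Rle_trans; [apply BG|unfold L; lra].
- intros x. eapply Rle_trans; [apply Ba|unfold L; lra].
- intros x. eapply Rle_trans; [apply Bg|unfold L; lra].
- lra.
- intros V A Hs HV0. apply (radial_small_shot V A); [apply Hrad; [exact Hs|lra]|lra|].
  rewrite HV0. exact Hlow.
- intros V A Hs HV0. apply Rnot_le_lt. intros HV1.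
  assert (V 0 <= c0 * phi 0); [|lra].
  apply (radial_large_shot V A) with lam1 b nu C B; auto; try lra.
  apply Hrad; [exact Hs|lra].
- exists V, A. split; [|split]; [apply Hrad; [exact Hs|lra]|lra|exact HV1].
Qed.

End Radial.

(** * Regularity and concavity of radial solutions *)

Lemma strictly_concave01_deriv (v v1 : R -> R) :
  (forall r, 0 < r < 1 -> derivable_pt_lim v r (v1 r)) ->
  (forall x y, 0 < x -> x < y -> y < 1 -> v1 y < v1 x) ->
  strictly_concave01 v.
Proof.
intros Hd Hdec.
assert (aux : forall x y t, 0 < x < 1 -> 0 < y < 1 -> x < y -> 0 < t < 1 ->
  v (t * x + (1 - t) * y) > t * v x + (1 - t) * v y).
{ intros x y t Hx Hy Hxy Ht. set (z := t * x + (1 - t) * y).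
  assert (Hzx : z - x = (1 - t) * (y - x)) by (unfold z; ring).
  assert (Hyz : y - z = t * (y - x)) by (unfold z; ring).
  assert (0 < (1 - t) * (y - x)) by (apply Rmult_lt_0_compat; lra).
  assert (0 < t * (y - x)) by (apply Rmult_lt_0_compat; lra).
  destruct (MVT_cor2 v v1 x z) as [c1 [E1 H1]]; [lra|intros; apply Hd; lra|].
  destruct (MVT_cor2 v v1 z y) as [c2 [E2 H2]]; [lra|intros; apply Hd; lra|].
  assert (Hc : v1 c2 < v1 c1) by (apply Hdec; lra).
  rewrite Hzx in E1. rewrite Hyz in E2.
  assert (Hp : 0 < t * (1 - t) * (y - x) * (v1 c1 - v1 c2)).
  { repeat apply Rmult_lt_0_compat; lra. }
  assert (t * (v z - v x) - (1 - t) * (v y - v z) =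
          t * (1 - t) * (y - x) * (v1 c1 - v1 c2)) by (rewrite E1, E2; ring).
  lra. }
intros x y t Hx Hy Hne Ht. destruct (Rlt_dec x y) as [Hlt|Hge].
- apply aux; auto.
- assert (Hyx : y < x) by lra. assert (Ht' : 0 < 1 - t < 1) by lra.
  generalize (aux y x (1 - t) Hy Hx Hyx Ht').
  replace ((1 - t) * y + (1 - (1 - t)) * x) with (t * x + (1 - t) * y) by ring. lra.
Qed.

Section Regularity.

Variables (N : nat) (h V A : R -> R).
Hypotheses (HN : (1 <= N)%nat) (h_cont : continuity h)
  (h_gt0 : forall s, 0 < s -> 0 < h s) (h_ge0 : forall s, 0 <= s -> 0 <= h s)
  (HVA : radial_sol N h V A) (HV0 : 0 < V 0) (HV1 : V 1 = 0).

Let CV := radial_cont_V N h V A HVA.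
Let CA := radial_cont_A N h V A HVA.
Let DV := radial_dV N h V A HVA.

Lemma sol_V_ge0 r : 0 <= r <= 1 -> 0 <= V r.
Proof.
intros Hr. rewrite <- HV1. apply (radial_V_noninc N h V A HVA); lra.
Qed.

Lemma sol_dA r : 0 <= r <= 1 -> derivable_pt_lim A r (INR N * r ^ (N - 1) * h (V r)).
Proof.
intros Hr. rewrite <- (Rmax_right 0 (V r)) by (apply sol_V_ge0, Hr).
apply (proj2 HVA r Hr).
Qed.

Lemma sol_weight_gt0 r s : 0 < r -> 0 < s -> 0 < INR N * r ^ (N - 1) * h s.
Proof.
intros Hr Hs. apply Rmult_lt_0_compat; [|apply h_gt0, Hs].
apply Rmult_lt_0_compat; [apply lt_0_INR; lia|apply pow_lt, Hr].
Qed.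

(** At this stage [V > 0] is known only near 0. There [A] grows strictly, and it never decreases
    afterwards; positivity of [V] up to 1 is then deduced from it. *)
Lemma sol_A_gt0 r : 0 < r <= 1 -> 0 < A r.
Proof.
intros Hr. assert (H01 : 0 <= 0 <= 1) by lra.
destruct (CV 0 H01 (V 0) HV0) as [d [Hd Hc]].
assert (Hm : 0 < Rmin r (d / 2)) by (apply Rmin_pos; lra).
pose proof (Rmin_l r (d / 2)). pose proof (Rmin_r r (d / 2)).
apply Rlt_le_trans with (A (Rmin r (d / 2))).
- rewrite <- (proj1 HVA).
  apply (increasing01 A (fun s => INR N * s ^ (N - 1) * h (V s))); try lra.
  + exact CA.
  + intros s Hs. apply sol_dA; lra.
  + intros s Hs. apply sol_weight_gt0; [lra|].
    specialize (Hc s). simpl in Hc. unfold Rdist in Hc.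
    assert (Hs' : Rabs (V s - V 0) < V 0).
    { apply Hc. split; [lra|]. rewrite Rminus_0_r, Rabs_pos_eq; lra. }
    apply Rabs_def2 in Hs'. lra.
- apply (radial_A_mono N h h_ge0 V A HVA); lra.
Qed.

Lemma sol_V_gt0 r : 0 <= r < 1 -> 0 < V r.
Proof.
intros Hr. destruct (MVT01 V _ r 1 CV DV) as [c [Hc E]]; try lra.
assert (0 < nroot N (A c)) by (apply nroot_gt0, sol_A_gt0; lra).
rewrite HV1 in E. nra.
Qed.

Lemma sol_strictly_concave : strictly_concave01 V.
Proof.
apply (strictly_concave01_deriv V (fun r => - nroot N (A r)) DV).
intros x y Hx Hxy Hy. apply Ropp_lt_contravar, nroot_lt; [exact HN|].
split; [left; apply sol_A_gt0; lra|].
apply (increasing01 A (fun s => INR N * s ^ (N - 1) * h (V s))); try lra.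
- exact CA.
- intros s Hs. apply sol_dA; lra.
- intros s Hs. apply sol_weight_gt0; [lra|]. apply sol_V_gt0; lra.
Qed.

(* [A r / r ^ N] extends continuously to [r = 0]; this is what makes
   [V' = - nroot N A] differentiable there. *)
Let w r := if Rle_dec r 0 then h (V 0) else A r / r ^ N.

Lemma quotient_0 : w 0 = h (V 0).
Proof. unfold w. destruct (Rle_dec 0 0); [reflexivity|lra]. Qed.

Lemma quotient_pos r : 0 < r -> w r = A r / r ^ N.
Proof. intros Hr. unfold w. destruct (Rle_dec r 0); [lra|reflexivity]. Qed.

Lemma quotient_gt0 r : 0 <= r <= 1 -> 0 < w r.
Proof.
intros [[Hr|<-] Hr1].
- rewrite quotient_pos by exact Hr. apply Rdiv_lt_0_compat; [apply sol_A_gt0; lra|].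
  apply pow_lt, Hr.
- rewrite quotient_0. apply h_gt0, HV0.
Qed.

Lemma sol_A_quotient r : 0 <= r <= 1 -> A r = r ^ N * w r.
Proof.
intros [[Hr|<-] Hr1].
- rewrite quotient_pos by exact Hr. field. apply pow_nonzero; lra.
- rewrite (proj1 HVA), pow_i by lia. ring.
Qed.

(** At 0: [h (V s)] stays within [eps / 2] of [h (V 0)], and integrating against the weight
    [N s^(N-1)] squeezes [A y] between the corresponding multiples of [y ^ N]. *)
Lemma quotient_cont01 : cont01 w.
Proof.
intros x [[Hx|<-] Hx1].
- assert (Hc : limit1_in (fun r => A r * / r ^ N)
    (fun y => 0 <= y <= 1) (A x * / x ^ N) x).
  { apply limit_mul; [apply CA; lra|].
    apply limit_inv; [apply cont01_pow; lra|apply pow_nonzero; lra]. }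
  intros eps Heps. destruct (Hc eps Heps) as [d [Hd Hlim]].
  exists (Rmin d x). split; [apply Rmin_pos; lra|].
  intros y [Hy Hyx]. rewrite (quotient_pos x Hx).
  assert (Hyx' : Rabs (y - x) < x) by (eapply Rlt_le_trans; [exact Hyx|apply Rmin_r]).
  apply Rabs_def2 in Hyx'. rewrite (quotient_pos y) by lra.
  apply Hlim. split; [exact Hy|]. eapply Rlt_le_trans; [exact Hyx|apply Rmin_l].
- intros eps Heps. assert (H01 : 0 <= 0 <= 1) by lra.
  destruct (cont01_comp h V h_cont CV 0 H01 (eps / 2)) as [d [Hd Hc]]; [lra|].
  exists (Rmin d 1). split; [apply Rmin_pos; lra|].
  intros y [Hy Hyd]. simpl in *. unfold Rdist in *. rewrite quotient_0.
  destruct Hy as [[Hy0|<-] Hy1].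
  2:{ rewrite quotient_0, Rminus_diag, Rabs_R0. exact Heps. }
  rewrite Rminus_0_r, Rabs_pos_eq in Hyd by lra.
  pose proof (Rmin_l d 1). pose proof (Rmin_r d 1).
  assert (Hnear : forall s, 0 < s < y ->
    h (V 0) - eps / 2 <= h (Rmax 0 (V s)) <= h (V 0) + eps / 2).
  { intros s Hs. rewrite Rmax_right by (apply sol_V_ge0; lra).
    assert (Hs' : Rabs (h (V s) - h (V 0)) < eps / 2).
    { apply Hc. split; [lra|]. rewrite Rminus_0_r, Rabs_pos_eq; lra. }
    apply Rabs_def2 in Hs'. lra. }
  assert (HyN : 0 < y ^ N) by (apply pow_lt, Hy0).
  assert (Hlow : (h (V 0) - eps / 2) * y ^ N <= A y).
  { apply (radial_A_lower N h HN V A HVA _ y); try lra. intros s Hs. apply Hnear, Hs. }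
  assert (Hup : A y <= (h (V 0) + eps / 2) * y ^ N).
  { apply (radial_A_upper N h V A HVA (fun s => (h (V 0) + eps / 2) * s ^ N)
      (fun s => INR N * s ^ (N - 1) * (h (V 0) + eps / 2)) y); try lra.
    - apply cont01_mult; [apply cont01_const|apply cont01_pow].
    - rewrite pow_i by lia. ring.
    - intros s _. apply derivable_pt_lim_scal_pow.
    - intros s Hs. apply Rmult_le_compat_l; [|apply Hnear, Hs].
      apply Rmult_le_pos; [apply pos_INR|apply pow_le; lra]. }
  rewrite (sol_A_quotient y) in Hlow, Hup by lra.
  apply Rabs_def1; nra.
Qed.

(** For [r > 0] the chain rule gives [nroot N (A r) / (N * A r)] times [N * r ^ (N - 1) * h (V r)].
    Inserting [A = r ^ N * w] cancels every power of [r], so the formula for V'' makes sense and is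
    continuous at 0. *)
Lemma sol_C2 :
  C2_01 V (fun r => - nroot N (A r)) (fun r => - (nroot N (w r) * / w r * h (V r))).
Proof.
split; [|split].
- intros x Hx. apply derivable_limit01, (proj2 HVA x Hx).
- intros x [[Hx|<-] Hx1].
  + apply (derivable_limit01 (fun r => - nroot N (A r))).
    apply (derivable_pt_lim_opp (fun r => nroot N (A r))).
    assert (HA : 0 < A x) by (apply sol_A_gt0; lra).
    assert (Hw : 0 < w x) by (apply quotient_gt0; lra).
    replace (nroot N (w x) * / w x * h (V x)) with
      (nroot N (A x) / (INR N * A x) * (INR N * x ^ (N - 1) * h (V x))).
    * apply (derivable_pt_lim_comp A (nroot N)); [apply sol_dA; lra|].
      apply nroot_derivable; assumption.
    * rewrite (sol_A_quotient x) by lra.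
      rewrite nroot_mult by (try apply pow_le; auto; lra).
      rewrite (nroot_eq N (x ^ N) x) by (auto; lra).
      replace (x ^ N) with (x * x ^ (N - 1)).
      2:{ replace (x ^ N) with (x ^ S (N - 1)) by (f_equal; lia). reflexivity. }
      field. repeat split; try lra; [apply pow_nonzero; lra|apply not_0_INR; lia].
  (* At 0 the difference quotient of V' is exactly [- nroot N (w y)]. *)
  + intros eps Heps.
    assert (H01 : 0 <= 0 <= 1) by lra.
    destruct (cont01_comp (nroot N) w (nroot_continuity N HN) quotient_cont01 0 H01 eps Heps)
      as [d [Hd Hc]].
    exists d. split; [exact Hd|]. intros y [[Hy Hne] Hyd].
    specialize (Hc y (conj Hy Hyd)). simpl in *. unfold Rdist in *.
    rewrite (proj1 HVA), nroot_0, (sol_A_quotient y Hy).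
    rewrite nroot_mult; [|exact HN|apply pow_le; lra|left; apply quotient_gt0, Hy].
    rewrite (nroot_eq N (y ^ N) y) by (auto; lra).
    replace ((- (y * nroot N (w y)) - - 0) / (y - 0)) with (- nroot N (w y))
      by (field; lra).
    rewrite quotient_0 in *.
    assert (0 < h (V 0)) by apply h_gt0, HV0.
    replace (nroot N (h (V 0)) * / h (V 0) * h (V 0)) with (nroot N (h (V 0)))
      by (field; lra).
    replace (- nroot N (w y) - - nroot N (h (V 0))) with
      (- (nroot N (w y) - nroot N (h (V 0)))) by ring.
    rewrite Rabs_Ropp. exact Hc.
- apply (cont01_comp Ropp).
  + apply continuity_Ropp.
  + apply cont01_mult; [apply cont01_mult|].
    * apply (cont01_comp (nroot N)); [apply nroot_continuity, HN|apply quotient_cont01].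
    * intros x Hx. apply limit_inv; [apply quotient_cont01, Hx|].
      apply Rgt_not_eq, quotient_gt0, Hx.
    * apply cont01_comp; [exact h_cont|exact CV].
Qed.

Lemma sol_equation r : 0 < r < 1 ->
  derivable_pt_lim (fun s => (- - nroot N (A s)) ^ N) r (INR N * r ^ (N - 1) * h (V r)).
Proof.
intros Hr. apply (derivable_ext01 A); [|exact Hr|apply sol_dA; lra].
intros z Hz. rewrite Ropp_involutive, pow_nroot; [reflexivity|exact HN|].
left; apply sol_A_gt0; lra.
Qed.

End Regularity.

(** * Positive solutions and reflection *)

Lemma positive_solution N f finf lam1 lam :
  (1 <= N)%nat -> cond_f1 N f -> f0_infinite N f -> 0 < finf -> finf_is N f finf ->
  first_eigenvalue N lam1 -> 0 < lam < lam1 / finf ->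
  exists v v1 v2 : R -> R, C2_01 v v1 v2 /\ v1 0 = 0 /\ v 1 = 0 /\
    (forall r, 0 < r < 1 -> 0 < v r) /\ strictly_concave01 v /\
    forall r, 0 < r < 1 -> derivable_pt_lim (fun s => (- v1 s) ^ N) r
      (lam ^ N * INR N * r ^ (N - 1) * f (v r)).
Proof.
intros HN [fc fpos] f0 Hfinf finfP [Hlam1 [[phi Hphi] _]] Hlam.
destruct (eigenfunction_profile N lam1 phi HN Hlam1 Hphi) as [B [b [Hb Hprof]]].
set (h := fun s => lam ^ N * f s).
assert (HlN : 0 < lam ^ N) by (apply pow_lt; lra).
assert (f_gt0 : forall s, 0 < s -> 0 < f s).
{ intros s Hs. assert (0 < s ^ N) by (apply pow_lt, Hs).
  assert (f s * s ^ N > 0) by (apply fpos; lra). nra. }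
assert (f_ge0 : forall s, 0 <= s -> 0 <= f s).
{ intros s [Hs|<-]; [left; apply f_gt0, Hs|].
  apply Rnot_lt_le. intros Hneg. assert (He : 0 < - f 0) by lra.
  destruct (fc 0 _ He) as [d [Hd Hc]]. specialize (Hc (d / 2)).
  simpl in Hc. unfold Rdist in Hc. rewrite Rminus_0_r, Rabs_pos_eq in Hc by lra.
  assert (0 < f (d / 2)) by (apply f_gt0; lra).
  assert (Hc' : Rabs (f (d / 2) - f 0) < - f 0).
  { apply Hc. split; [split; [exact I|lra]|lra]. }
  apply Rabs_def2 in Hc'. lra. }
assert (h_gt0 : forall s, 0 < s -> 0 < h s).
{ intros s Hs. apply Rmult_lt_0_compat; auto. }
assert (h_ge0 : forall s, 0 <= s -> 0 <= h s).
{ intros s Hs. apply Rmult_le_pos; [lra|auto]. }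
assert (hc : continuity h) by (apply (continuity_scal f), fc).
(* After multiplication by [lam ^ N] this is the constant 16 of [radial_small_shot]. *)
destruct (f0 ((16 / lam) ^ N)) as [d [Hd Hf0]].
assert (Hlow : forall s, 0 < s <= d / 2 -> (16 * s) ^ N <= h s).
{ intros s Hs. specialize (Hf0 s). rewrite Rabs_pos_eq in Hf0 by lra.
  assert (HsN : 0 < s ^ N) by (apply pow_lt; lra).
  assert (Hq : (16 / lam) ^ N * s ^ N <= f s).
  { apply Rle_trans with (f s / s ^ N * s ^ N); [|right; field; lra].
    apply Rmult_le_compat_r; [lra|]. left; apply Hf0; lra. }
  replace (16 * s) with (lam * (16 / lam * s)) by (field; lra).
  rewrite !(Rpow_mult_distr _ (_ * s)), (Rpow_mult_distr _ s).
  apply Rmult_le_compat_l; lra. }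
assert (Hprod : lam * finf < lam1).
{ apply Rlt_le_trans with (lam1 / finf * finf); [nra|right; field; lra]. }
(* The midpoint leaves room on both sides: [finf < nu / lam] gives the growth bound for large [s],
   and [nu < lam1] the contraction. *)
set (nu := (lam * finf + lam1) / 2).
assert (Hlf : 0 < lam * finf) by (apply Rmult_lt_0_compat; lra).
assert (Hnu : 0 < nu < lam1) by (unfold nu; lra).
assert (Heps : 0 < (nu / lam) ^ N - finf ^ N).
{ apply Rlt_0_minus, pow_lt_mono; [exact HN|]. split; [lra|].
  apply Rlt_div_r; [lra|]. unfold nu. lra. }
destruct (finfP _ Heps) as [K HK].
(* [K] may be negative; [K1 >= 1] makes [[0, K1]] an interval and [s] positive beyond it. *)
set (K1 := Rmax K 1).
assert (HK1 : K <= K1 /\ 1 <= K1) by (split; [apply Rmax_l|apply Rmax_r]).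
destruct (continuity_clip_bounded h 0 K1 hc) as [C [HC HCb]]; [lra|].
assert (Hup : forall s, 0 <= s -> h s <= (nu * s) ^ N + C).
{ intros s Hs. destruct (Rle_dec s K1) as [Hsk|Hsk].
  - specialize (HCb s). rewrite clip_id in HCb by lra.
    assert (0 <= (nu * s) ^ N) by (apply pow_le, Rmult_le_pos; lra).
    generalize (Rle_abs (h s)). lra.
  - specialize (HK s). rewrite (Rabs_pos_eq s) in HK by lra.
    assert (Hq : Rabs (f s / s ^ N - finf ^ N) < (nu / lam) ^ N - finf ^ N)
      by (apply HK; lra).
    apply Rabs_def2 in Hq.
    assert (HsN : 0 < s ^ N) by (apply pow_lt; lra).
    assert (Hfs : f s <= (nu / lam) ^ N * s ^ N).
    { apply Rle_trans with (f s / s ^ N * s ^ N); [right; field; lra|].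
      apply Rmult_le_compat_r; lra. }
    replace (nu * s) with (lam * (nu / lam * s)) by (field; lra).
    rewrite (Rpow_mult_distr lam), (Rpow_mult_distr _ s).
    assert (h s <= lam ^ N * ((nu / lam) ^ N * s ^ N)).
    { apply Rmult_le_compat_l; lra. }
    lra. }
destruct (radial_exists N h HN h_ge0 lam1 b nu C phi B (d / 2))
  as [V [A [HVA [HV0 HV1]]]]; auto; [lra|].
exists V, (fun r => - nroot N (A r)). eexists.
split; [apply (sol_C2 N h V A HN hc h_gt0 h_ge0 HVA HV0 HV1)|].
split; [rewrite (proj1 HVA), nroot_0; ring|].
split; [exact HV1|].
split; [intros r Hr; apply (sol_V_gt0 N h V A HN h_gt0 h_ge0 HVA HV0 HV1); lra|].
split; [apply (sol_strictly_concave N h V A HN h_gt0 h_ge0 HVA HV0 HV1)|].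
intros r Hr.
replace (lam ^ N * INR N * r ^ (N - 1) * f (V r)) with
  (INR N * r ^ (N - 1) * h (V r)) by (unfold h; ring).
apply (sol_equation N h V A HN h_gt0 h_ge0 HVA HV0 HV1 r Hr).
Qed.

Lemma deriv01_opp u u' : deriv01 u u' -> deriv01 (fun x => - u x) (fun x => - u' x).
Proof.
intros H x Hx eps Heps. destruct (H x Hx eps Heps) as [d [Hd Hc]].
exists d. split; [exact Hd|]. intros y Hy. specialize (Hc y Hy).
destruct Hy as [[_ Hne] _]. simpl in *. unfold Rdist in *.
replace ((- u y - - u x) / (y - x) - - u' x)
  with (- ((u y - u x) / (y - x) - u' x)) by (field; lra).
rewrite Rabs_Ropp. exact Hc.
Qed.

Lemma C2_01_opp u u1 u2 :
  C2_01 u u1 u2 -> C2_01 (fun x => - u x) (fun x => - u1 x) (fun x => - u2 x).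
Proof.
intros [H1 [H2 H3]]. split; [|split].
- apply deriv01_opp, H1.
- apply deriv01_opp, H2.
- apply (cont01_comp Ropp); [apply continuity_Ropp|exact H3].
Qed.

Definition reflect_nl (N : nat) (f : R -> R) (s : R) : R := (-1) ^ N * f (- s).

Lemma pow_opp1_sqr N : (-1) ^ N * (-1) ^ N = 1.
Proof. rewrite <- Rpow_mult_distr. replace (-1 * -1) with 1 by ring. apply pow1. Qed.

Lemma pow_opp N x : (- x) ^ N = (-1) ^ N * x ^ N.
Proof. rewrite <- Rpow_mult_distr. f_equal. ring. Qed.

(** The limits at 0 and at infinity are two-sided, hence insensitive to the change from [s] to
    [-s]. *)
Lemma reflect_nl_quotient N f s : reflect_nl N f s / s ^ N = f (- s) / (- s) ^ N.
Proof.
unfold reflect_nl, Rdiv. rewrite (pow_opp N s), Rinv_mult.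
replace (/ (-1) ^ N) with ((-1) ^ N); [ring|].
apply Rmult_eq_reg_l with ((-1) ^ N); [|apply pow_nonzero; lra].
rewrite pow_opp1_sqr, Rinv_r; [reflexivity|apply pow_nonzero; lra].
Qed.

Lemma cond_f1_reflect N f : cond_f1 N f -> cond_f1 N (reflect_nl N f).
Proof.
intros [Hc Hp]. split.
- apply (continuity_scal (fun s => f (- s))).
  apply (continuity_comp Ropp f); [apply continuity_Ropp|exact Hc].
- intros s Hs. unfold reflect_nl.
  replace ((-1) ^ N * f (- s) * s ^ N) with (f (- s) * (- s) ^ N)
    by (rewrite pow_opp; ring).
  apply Hp. lra.
Qed.

Lemma f0_infinite_reflect N f : f0_infinite N f -> f0_infinite N (reflect_nl N f).
Proof.
intros H M. destruct (H M) as [d [Hd Hs]]. exists d. split; [exact Hd|].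
intros s H1. rewrite reflect_nl_quotient. apply Hs. rewrite Rabs_Ropp. exact H1.
Qed.

Lemma finf_is_reflect N f finf : finf_is N f finf -> finf_is N (reflect_nl N f) finf.
Proof.
intros H eps Heps. destruct (H eps Heps) as [K HK]. exists K.
intros s H1. rewrite reflect_nl_quotient. apply HK. rewrite Rabs_Ropp. exact H1.
Qed.

Theorem theorem4p8 (N : nat) (f : R -> R) (finf lam1 : R) :
  (1 <= N)%nat ->
  cond_f1 N f ->
  f0_infinite N f ->
  0 < finf -> finf_is N f finf ->
  first_eigenvalue N lam1 ->
  forall lam, 0 < lam < lam1 / finf ->
    exists up um : R -> R,
      solves_MO N f lam up /\ solves_MO N f lam um /\
      (forall r, 0 < r < 1 -> 0 < up r) /\ strictly_concave01 up /\
      (forall r, 0 < r < 1 -> um r < 0) /\ strictly_convex01 um.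
Proof.
intros HN Hf1 Hf0 Hfinf Hinf Hlam1 lam Hlam.
destruct (positive_solution N f finf lam1 lam)
  as [v [v1 [v2 [vC2 [v10 [v1b [vpos [vconc veq]]]]]]]]; auto.
destruct (positive_solution N (reflect_nl N f) finf lam1 lam)
  as [p [p1 [p2 [pC2 [p10 [p1b [ppos [pconc peq]]]]]]]];
  auto using cond_f1_reflect, f0_infinite_reflect, finf_is_reflect.
(* The equation contains [f (- u)]: the profile [v] for [f] itself gives the negative solution, and
   the profile [p] for the reflected nonlinearity the positive one. *)
exists p, (fun r => - v r). split; [|split; [|split; [|split; [|split]]]].
- exists p1, p2. repeat split; try apply pC2; auto.
  intros r Hr. specialize (peq r Hr).
  apply (derivable_ext01 (fun s => (-1) ^ N * (- p1 s) ^ N)); [|exact Hr|].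
  { intros s _. rewrite (pow_opp N (p1 s)), <- Rmult_assoc, pow_opp1_sqr. ring. }
  replace (lam ^ N * INR N * r ^ (N - 1) * f (- p r)) with
    ((-1) ^ N * (lam ^ N * INR N * r ^ (N - 1) * reflect_nl N f (p r))).
  + apply (derivable_pt_lim_scal (fun s => (- p1 s) ^ N)), peq.
  + unfold reflect_nl.
    transitivity ((-1) ^ N * (-1) ^ N * (lam ^ N * INR N * r ^ (N - 1) * f (- p r)));
      [ring|rewrite pow_opp1_sqr; ring].
- exists (fun r => - v1 r), (fun r => - v2 r).
  split; [apply C2_01_opp, vC2|]. split; [rewrite v10; ring|].
  split; [rewrite v1b; ring|]. intros r Hr. rewrite Ropp_involutive. apply veq, Hr.
- exact ppos.
- exact pconc.
- intros r Hr. specialize (vpos r Hr). lra.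
- intros x y t Hx Hy Hne Ht. specialize (vconc x y t Hx Hy Hne Ht). lra.
Qed.
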